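(* Let $n\ge1$, let $\Omega\subset\mathbb{R}^n$ be a smooth bounded domain, $\mu\ge0$, let $\gamma\in C^3([0,\infty))$ satisfy $\gamma>0$ and $\gamma'\le0$ on $(0,\infty)$, and let $u_0\in C^0(\overline\Omega)$, $u_0\ge0$, $u_0\not\equiv0$. Let $(u,v)$ be the classical solution, on its maximal existence interval $[0,T_{\max})$, of $$\begin{cases} u_t=\Delta(\gamma(v)u)+\mu u(1-u), & x\in\Omega,\ t>0,\\ -\Delta v+v=u, & x\in\Omega,\ t>0,\\ \partial_\nu u=\partial_\nu v=0, & x\in\partial\Omega,\ t>0,\\ u(x,0)=u_0(x), & x\in\Omega.\end{cases}$$ Then for any $x\in\Omega$ and $0\le t<T_{\max}$, $$v(x,t)\le v_0(x)\,e^{(\gamma(v_* )+\mu)t},$$ where $v_0:=(I-\Delta)^{-1}u_0$ and $v_*$ is the lower bound for $v$ defined in the context.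
   Context: $(I-\Delta)^{-1}$ is the inverse of $I-\Delta$, where $\Delta$ is the Laplacian on $\Omega$ with homogeneous Neumann boundary condition. The problem has a unique classical solution $(u,v)\in\big(C^0(\overline\Omega\times[0,T_{\max}))\cap C^{2,1}(\overline\Omega\times(0,T_{\max}))\big)^2$ with maximal existence time $T_{\max}\in(0,\infty]$. Convention for $v_*$: if $\mu>0$, $v_*:=0$; if $\mu=0$, $v_*>0$ is a constant depending only on $n,\Omega,\|u_0\|_{L^1(\Omega)}$ such that $\inf_{x\in\Omega}v(x,t)\ge v_*$ for all $t\in(0,T_{\max})$ (such a constant exists by a known result). *)

(* Defs.v *)
From mathcomp Require Import all_boot all_order all_algebra.
From mathcomp Require Import all_classical all_reals all_analysis.

Set Implicit Arguments.
Unset Strict Implicit.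
Unset Printing Implicit Defensive.

Import Order.TTheory GRing.Theory Num.Theory.
Import numFieldNormedType.Exports.

Local Open Scope classical_set_scope.
Local Open Scope ring_scope.

Section Calculus.
Context {R : realType} {n : nat}.
Implicit Types (Omega U : set 'rV[R]_n) (f w : 'rV[R]_n -> R).

Definition basis_vector (i : 'I_n) : 'rV[R]_n := delta_mx 0 i.

Definition partial (i : 'I_n) f : 'rV[R]_n -> R :=
  fun x => 'D_(basis_vector i) f x.

Definition laplacian f : 'rV[R]_n -> R :=
  fun x => \sum_(i < n) partial i (partial i f) x.

Definition gradient f (x : 'rV[R]_n) : 'rV[R]_n := \row_i partial i f x.

(* The library norm on 'rV[R]_n is the sup norm (same topology); unit normals
   need the Euclidean one. *)
Definition euclidean_norm (a : 'rV[R]_n) : R :=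
  Num.sqrt (\sum_(i < n) a 0 i ^+ 2).

Definition smooth_on U f : Prop :=
  forall (s : seq 'I_n) x, U x ->
    {for x, continuous (foldr partial f s)} /\
    (forall i, derivable (foldr partial f s) x (basis_vector i)).

Definition boundary Omega : set 'rV[R]_n := closure Omega `\` interior Omega.

Definition local_defining_function Omega (x0 : 'rV[R]_n) (rho : 'rV[R]_n -> R)
    : Prop :=
  exists U, [/\ open U, U x0, smooth_on U rho,
    (forall x, U x -> (Omega x <-> rho x < 0)) &
    (forall x, U x -> gradient rho x != 0)].

Definition smooth_bounded_domain Omega : Prop :=
  [/\ open Omega, connected Omega, Omega !=set0, bounded_set Omega &
      forall x0, boundary Omega x0 ->
        exists rho, local_defining_function Omega x0 rho].

Definition outward_unit_normal Omega (x nu : 'rV[R]_n) : Prop :=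
  exists2 rho, local_defining_function Omega x rho &
    nu = (euclidean_norm (gradient rho x))^-1 *: gradient rho x.

(* Functions on the closure of Omega are represented by functions on the whole
   space whose values outside the closure are irrelevant. At a boundary point
   the partial derivatives are therefore the limits of the interior ones. *)
Definition normal_derivative Omega w (x nu : 'rV[R]_n) : R :=
  \sum_(i < n) nu 0 i * lim (partial i w y @[y --> within Omega (nbhs x)]).

Definition neumann_condition Omega w : Prop :=
  forall x nu, boundary Omega x -> outward_unit_normal Omega x nu ->
    normal_derivative Omega w x nu = 0.

End Calculus.

Definition extends_continuously {T U : topologicalType} (D E : set T)
    (f : T -> U) : Prop :=
  exists2 g : T -> U, {within E, continuous g} & forall x, D x -> g x = f x.

Section Spaces.
Context {R : realType} {n : nat}.
Implicit Types (Omega : set 'rV[R]_n).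

Definition C3_half_line (gamma : R -> R) : Prop :=
  [/\ {within `[0, +oo[, continuous gamma},
      (forall k y, (k < 3)%N -> 0 < y -> derivable (derive1n k gamma) y 1) &
      (forall k, (k <= 3)%N ->
         @extends_continuously R R `]0, +oo[ `[0, +oo[ (derive1n k gamma))].

Definition C2_closure Omega (w : 'rV[R]_n -> R) : Prop :=
  [/\ {within closure Omega, continuous w},
      (forall i x, Omega x -> derivable w x (basis_vector i)),
      (forall i j x, Omega x -> derivable (partial j w) x (basis_vector i)),
      (forall i, extends_continuously Omega (closure Omega) (partial i w)) &
      (forall i j,
         extends_continuously Omega (closure Omega) (partial i (partial j w)))].

Definition time_co (T : \bar R) : set R := [set t | 0 <= t /\ (t%:E < T)%E].
Definition time_oo (T : \bar R) : set R := [set t | 0 < t /\ (t%:E < T)%E].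

Definition time_derivative (u : 'rV[R]_n -> R -> R) (x : 'rV[R]_n) (t : R) : R :=
  derive1 (u x) t.

Definition C0_cylinder Omega (T : \bar R) (u : 'rV[R]_n -> R -> R) : Prop :=
  {within closure Omega `*` time_co T,
    continuous (fun p : 'rV[R]_n * R => u p.1 p.2)}.

Definition C21_cylinder Omega (T : \bar R) (u : 'rV[R]_n -> R -> R) : Prop :=
  let ext (f : 'rV[R]_n -> R -> R) :=
    extends_continuously (Omega `*` time_oo T) (closure Omega `*` time_oo T)
      (fun p : 'rV[R]_n * R => f p.1 p.2) in
  [/\ {within closure Omega `*` time_oo T,
        continuous (fun p : 'rV[R]_n * R => u p.1 p.2)},
      (forall x t, Omega x -> time_oo T t -> [/\ derivable (u x) t 1,
         (forall i, derivable (u ^~ t) x (basis_vector i)) &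
         (forall i j, derivable (partial j (u ^~ t)) x (basis_vector i))]),
      ext (time_derivative u),
      (forall i, ext (fun x t => partial i (u ^~ t) x)) &
      (forall i j, ext (fun x t => partial i (partial j (u ^~ t)) x))].

(* The graph of the Neumann Laplacian as a closed operator in C^0(closure Omega):
   the closure, for uniform convergence, of the classical Laplacian on
   { w in C^2(closure Omega) : d w / d nu = 0 on the boundary }. The closure is
   needed because (I - Delta)^{-1} f is in general not C^2 when f is merely
   continuous. *)
Definition neumann_laplacian Omega (w g : 'rV[R]_n -> R) : Prop :=
  [/\ {within closure Omega, continuous w},
      {within closure Omega, continuous g} &
      forall e : R, 0 < e -> exists phi : 'rV[R]_n -> R,
        [/\ C2_closure Omega phi, neumann_condition Omega phi &
            forall x, Omega x ->
              `|phi x - w x| < e /\ `|laplacian phi x - g x| < e]].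

(* (I - Delta)^{-1} f : the w with w - Delta w = f; only the values of w on
   the closure of Omega are determined. *)
Definition inv_I_sub_neumann_laplacian Omega (f : 'rV[R]_n -> R)
    : 'rV[R]_n -> R :=
  xget (fun=> 0)
    [set w | neumann_laplacian Omega w (fun x => w x - f x)].

(* As gamma is only given on [0, oo), gamma(v) is meaningful only for v >= 0
   (field csol_dom); this also makes the notion independent of the
   values of the function gamma on negative reals. *)
Record classical_solution Omega (mu : R) (gamma : R -> R) (u0 : 'rV[R]_n -> R)
    (T : \bar R) (u v : 'rV[R]_n -> R -> R) : Prop := ClassicalSolution {
  csol_u_C0 : C0_cylinder Omega T u;
  csol_v_C0 : C0_cylinder Omega T v;
  csol_u_C21 : C21_cylinder Omega T u;
  csol_v_C21 : C21_cylinder Omega T v;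
  csol_dom : forall x t, Omega x -> time_oo T t -> 0 <= v x t;
  csol_u_eq : forall x t, Omega x -> time_oo T t ->
    time_derivative u x t =
      laplacian (fun y => gamma (v y t) * u y t) x + mu * u x t * (1 - u x t);
  csol_v_eq : forall x t, Omega x -> time_oo T t ->
    - laplacian (v ^~ t) x + v x t = u x t;
  csol_u_neumann : forall t, time_oo T t -> neumann_condition Omega (u ^~ t);
  csol_v_neumann : forall t, time_oo T t -> neumann_condition Omega (v ^~ t);
  csol_init : forall x, Omega x -> u x 0 = u0 x
}.

Definition maximal_classical_solution Omega (mu : R) (gamma : R -> R)
    (u0 : 'rV[R]_n -> R) (Tmax : \bar R) (u v : 'rV[R]_n -> R -> R) : Prop :=
  [/\ (0 < Tmax)%E, classical_solution Omega mu gamma u0 Tmax u v &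
      forall (T : \bar R) (u' v' : 'rV[R]_n -> R -> R),
        classical_solution Omega mu gamma u0 T u' v' ->
        (forall x t, closure Omega x -> time_co Tmax t ->
           u' x t = u x t /\ v' x t = v x t) ->
        (T <= Tmax)%E].

(* The constant v_* is usually fixed as a function of n, Omega and the L^1 norm of
   u_0 only; any number with the property below is allowed here. *)
Definition is_v_star Omega (mu : R) (Tmax : \bar R) (v : 'rV[R]_n -> R -> R)
    (vstar : R) : Prop :=
  (0 < mu -> vstar = 0) /\
  (mu = 0 -> 0 < vstar /\
     forall t, time_oo Tmax t -> vstar <= inf [set v x t | x in Omega]).

End Spaces.

(* Main.v *)
(* With [z = gamma(v) u] and [f = mu u (1 - u)], the equations give
   [(I - Delta)(v_t + z) = z + f]. Once [u >= 0] is known, [z + f] is at most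
   [(gamma(vstar) + mu) u = (I - Delta)((gamma(vstar) + mu) v)], because
   [gamma] is nonincreasing; the comparison principle for [I - Delta] with Neumann
   condition then yields [v_t <= (gamma(vstar) + mu) v], and one integrates in time.

   Nonnegativity of [u] comes from
   [z_t = gamma(v) Delta z + (mu (1 - u) + gamma'(v) v_t / gamma(v)) z]: unlike
   the equation for [u] itself, this one involves no gradient of [v], and its
   zeroth-order coefficient is bounded up to [t = 0], since the same comparison
   bounds [v_t + z].

   Both maximum principles rest on the fact that a Neumann function which is C^2 up
   to the boundary has nonpositive Laplacian at a maximum, even a boundary one. *)

Require Import Defs.
From mathcomp Require Import all_boot all_order all_algebra.
From mathcomp Require Import all_classical all_reals all_analysis.
From mathcomp Require Import ring lra.
Set Implicit Arguments.
Unset Strict Implicit.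
Unset Printing Implicit Defensive.
Import Order.TTheory GRing.Theory Num.Theory.
Import numFieldNormedType.Exports.
Local Open Scope classical_set_scope.
Local Open Scope ring_scope.

(** * Partial and directional derivatives *)

(** The identity for $(I-\Delta)(v_t+z)$ is the time derivative of $v-\Delta v=u$ combined with
    $u_t=\Delta z+f$: the two copies of $\Delta z$ cancel. No $\nabla v$ enters the equation for $z$
    because the diffusion in $u_t$ is $\Delta z$ as a whole, so that only $\partial_t$ falls on
    $\gamma(v)$. Nonnegativity of $u$ is not part of the notion of solution, yet it serves twice: to
    drop $z$ from $v_t+z$, and to replace the factor $\gamma(v)$ of $u$ by [gamma vstar].

    The obstacles are of regularity. Derivatives on the boundary exist only as limits from inside,
    and a tangential segment may leave $\Omega$; so a boundary maximum is tested along inward rays,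
    and the coordinate directions are reached in the limit. As [gamma] is given on $[0,\infty)$ and
    $v$ is only known to be $\ge0$, a $C^2$ function [h] on the whole line takes its place. Finally,
    $v(\cdot,0)$ need not be $C^2$; it is identified with $v_0$ through the closed graph, the slices
    $v(\cdot,t)$ with $t\to0$ being the classical approximants. *)

Section DirectionalDerivatives.
Context {R : realType}.

Lemma line_quotient {V : normedModType R} (f : V -> R) (x d : V) (s : R) :
  (fun h : R => h^-1 *: (((fun r => f (x + r *: d)) \o shift s) (h *: (1 : R))
     - f (x + s *: d))) =
  (fun h : R => h^-1 *: ((f \o shift (x + s *: d)) (h *: d) - f (x + s *: d))).
Proof.
apply/funext => h /=; congr (_ *: (f _ - _)).
by rewrite [h *: (1 : R)]mulr1 scalerDl addrCA.
Qed.

Lemma is_derive_line {V : normedModType R} (f : V -> R) (x d : V) (s l : R) :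
  is_derive (x + s *: d) d f l -> is_derive s 1 (fun r => f (x + r *: d)) l.
Proof.
case=> H1 H2; split.
  by rewrite /derivable line_quotient; exact: H1.
by rewrite /derive line_quotient; exact: H2.
Qed.

Lemma is_derive_from_line {V : normedModType R} (f : V -> R) (x d : V) (l : R) :
  is_derive (0 : R) 1 (fun r => f (x + r *: d)) l -> is_derive x d f l.
Proof.
have := line_quotient f x d 0; rewrite scale0r addr0 => E.
case; rewrite /derivable /derive scale0r addr0 E => H1 H2; split.
  exact: H1.
exact: H2.
Qed.

(** Locating the intermediate point by [|c| <= |a|] treats both signs of [a] at once and is what
    estimates on balls require. *)
Lemma MVT_line {V : normedModType R} (f : V -> R) (x e : V) (a : R) :
  (forall r, `|r| <= `|a| -> derivable f (x + r *: e) e) ->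
  exists2 c, `|c| <= `|a| & f (x + a *: e) - f x = a * 'D_e f (x + c *: e).
Proof.
move=> df; pose g r := f (x + r *: e).
have dg (r : R) : `|r| <= `|a| -> is_derive r 1 g ('D_e f (x + r *: e)).
  by move=> ra; apply: is_derive_line; apply: derivableP; apply: df.
have cg (b c : R) : b <= c -> (forall r, b <= r <= c -> `|r| <= `|a|) ->
    {within `[b, c], continuous g}.
  move=> bc H; apply: derivable_within_continuous => r.
  by rewrite in_itv/= => /H/dg [].
have [a0|a0|a0] := ltrgtP 0 a.
- have H (r : R) : 0 <= r <= a -> `|r| <= `|a|.
    by move=> /andP[r0 ra]; rewrite ger0_norm// gtr0_norm.
  have D (r : R) : r \in `]0, a[ -> is_derive r 1 g ('D_e f (x + r *: e)).
    by rewrite in_itv/= => /andP[r0 ra]; apply/dg/H; rewrite !ltW.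
  have [c] := MVT a0 D (cg _ _ (ltW a0) H).
  rewrite in_itv/= => /andP[c0 ca]; rewrite /g scale0r addr0 subr0 => ->.
  exists c; last by rewrite mulrC.
  by apply: H; rewrite !ltW.
- have H (r : R) : a <= r <= 0 -> `|r| <= `|a|.
    by move=> /andP[ra r0]; rewrite ler0_norm// ltr0_norm// lerN2.
  have D (r : R) : r \in `]a, 0[ -> is_derive r 1 g ('D_e f (x + r *: e)).
    by rewrite in_itv/= => /andP[r0 ra]; apply/dg/H; rewrite !ltW.
  have [c] := MVT a0 D (cg _ _ (ltW a0) H).
  rewrite in_itv/= => /andP[c0 ca]; rewrite /g scale0r addr0 sub0r => E.
  exists c; last by rewrite -opprB E mulrN opprK mulrC.
  by apply: H; rewrite !ltW.
- by exists 0; rewrite -?a0 ?normr0// scale0r addr0 subrr mul0r.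
Qed.

Lemma rV_norm_le {n} (v : 'rV[R]_n) (r : R) :
  0 <= r -> (forall j, `|v 0 j| <= r) -> `|v| <= r.
Proof.
move=> r0 vr; rewrite [leLHS]/Num.norm /= mx_normrE; apply/bigmax_leP; split=> //.
by move=> [i j] _ /=; rewrite ord1.
Qed.

(** The classical telescoping argument: the segment from $x$ to $x+hd$ is replaced by a path along
    the coordinate axes, the mean value theorem is applied on each edge, and continuity of the
    partial derivatives at $x$ compares the results with [partial i f x]. *)
Lemma partial_is_derive {n} (f : 'rV[R]_n -> R) x :
  (\forall y \near x, forall i, derivable f y (basis_vector i)) ->
  (forall i, {for x, continuous (partial i f)}) ->
  forall d : 'rV[R]_n, is_derive x d f (\sum_i d 0 i * partial i f x).
Proof.
move=> /nbhs_ballP[r1/= r10 H1] cf d.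
set S := \sum_i _.
have E : (fun h => h^-1 *: ((f \o shift x) (h *: d) - f x)) @ 0^' --> S; last first.
  by split; [apply/cvg_ex; exists S | exact/cvg_lim].
apply/cvgrPdist_le => e e0.
(* [A] dominates each $|d_k|$ as well as their sum; the summand 1 keeps it positive when $d=0$. *)
pose A := 1 + \sum_i `|d 0 i|.
have A0 : 0 < A by rewrite ltr_pwDl// sumr_ge0.
have /filter_forall /nbhs_ballP[r2/= r20 H2] i : \forall y \near x,
    `|partial i f x - partial i f y| <= e / A.
  by apply: (proj1 (cvgrPdist_le _ _) (cf i)); rewrite divr_gt0.
pose r := Num.min r1 r2.
have r0 : 0 < r by rewrite lt_min; apply/andP.
have dA k : `|d 0 k| <= A.
  by rewrite /A (bigD1 k)//= addrCA ler_wpDr// addr_ge0// sumr_ge0.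
rewrite near_withinE; apply/nbhs_ballP.
exists (r / (2 * A)) => /=; first by rewrite divr_gt0// mulr_gt0.
move=> h; rewrite /ball/= sub0r normrN => hr h0.
have hA : `|h| * A <= r / 2.
  by rewrite -ler_pdivlMr// (le_trans (ltW hr))// -mulrA -invfM.
(* The corners of the path: at [p k] the first [k] coordinates have been moved. *)
pose p (k : nat) : 'rV[R]_n := x + h *: \row_i (if (i < k)%N then d 0 i else 0).
have p0 : p 0%N = x.
  rewrite /p; set v := \row_i _; suff -> : v = 0 by rewrite scaler0 addr0.
  by apply/rowP => i; rewrite !mxE.
have pn : p n = h *: d + x.
  rewrite /p addrC; congr (_ *: _ + _); apply/rowP => i.
  by rewrite !mxE ltn_ord.
have pS (k : 'I_n) : p k.+1 = p k + (h * d 0 k) *: basis_vector k.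
  rewrite /p -addrA -scalerA -scalerDr; congr (_ + _ *: _); apply/rowP => i.
  rewrite !mxE eqxx ltnS leq_eqVlt /=.
  have [->|ik] := eqVneq i k; first by rewrite eqxx ltnn add0r mulr1.
  by rewrite (inj_eq val_inj) (negbTE ik) /= mulr0 addr0.
have pball (k : 'I_n) c : `|c| <= `|h * d 0 k| -> ball x r (p k + c *: basis_vector k).
  move=> ck; rewrite mx_norm_ball /ball_ /= /p -addrA opprD addrA subrr sub0r normrN.
  apply: le_lt_trans (_ : r / 2 < r); last by rewrite gtr_pMr// invf_lt1// ltr1n.
  apply: le_trans hA; apply: rV_norm_le => [|j]; first by rewrite mulr_ge0// ltW.
  rewrite !mxE eqxx /=.
  have [->|jk] := eqVneq j k.
    by rewrite ltnn mulr0 add0r mulr1 (le_trans ck)// normrM ler_wpM2l.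
  rewrite mulr0 addr0 normrM ler_wpM2l//.
  by case: ifP => // _; rewrite normr0 ltW.
have step (k : 'I_n) : `|f (p k.+1) - f (p k) - h * d 0 k * partial k f x|
    <= `|h| * `|d 0 k| * (e / A).
  rewrite pS; have [c ck E] : exists2 c, `|c| <= `|h * d 0 k| &
      f (p k + (h * d 0 k) *: basis_vector k) - f (p k) =
      (h * d 0 k) * 'D_(basis_vector k) f (p k + c *: basis_vector k).
    apply: MVT_line => c ck; apply: (H1 _ _ k).
    by apply: le_ball (pball _ _ ck); rewrite ge_min lexx.
  rewrite E -mulrBr !normrM ler_wpM2l//.
  rewrite distrC; apply: (H2 _ _ k).
  by apply: le_ball (pball _ _ ck); rewrite ge_min lexx orbT.
rewrite /= -pn -p0.
have -> : f (p n) - f (p 0%N) = \sum_(k < n) (f (p k.+1) - f (p k)).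
  by rewrite -(telescope_sumr (fun k => f (p k)) (leq0n n)) big_mkord.
set D := \sum_(k < n) _.
have -> : S - h^-1 *: D = h^-1 * (h * S - D) by rewrite mulrBr mulKf.
rewrite normrM normfV ler_pdivrMl ?normr_gt0// distrC /D.
rewrite /S mulr_sumr -sumrB.
apply: le_trans (ler_norm_sum _ _ _) _.
apply: le_trans (_ : \sum_(k < n) `|h| * `|d 0 k| * (e / A) <= _).
  by apply: ler_sum => k _; rewrite mulrA.
rewrite -mulr_suml -mulr_sumr -mulrA ler_wpM2l// mulrCA ger_pMr// ler_pdivrMr//.
by rewrite mul1r lerDr.
Qed.

End DirectionalDerivatives.

(** * Interior limits of extensions, and derivative tests at an endpoint *)

Section Limits.
Context {R : realType}.

Lemma cvg_sumr {T : Type} {F : set_system T} {FF : Filter F} (I : finType)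
    (f : I -> T -> R) (l : I -> R) :
  (forall i, f i x @[x --> F] --> l i) ->
  (\sum_i f i x) @[x --> F] --> \sum_i l i.
Proof.
move=> fl; elim: (index_enum I) => [|i s IH].
  rewrite big_nil; under eq_fun do rewrite big_nil; exact: cvg_cst.
under eq_fun do rewrite big_cons; rewrite big_cons.
exact: cvgD.
Qed.

(** Converts the extension clauses of the regularity classes into limits from inside, the form in
    which boundary derivatives enter [normal_derivative]. *)
Lemma extension_cvg {T U : topologicalType} (D E : set T) (f g : T -> U) :
  D `<=` E -> {within E, continuous g} -> (forall x, D x -> g x = f x) ->
  forall x, E x -> f y @[y --> within D (nbhs x)] --> g x.
Proof.
move=> DE /subspace_continuousP cg gf x Ex.
apply: cvg_trans (_ : g y @[y --> within D (nbhs x)] --> _).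
  by apply: near_eq_cvg; rewrite near_withinE; apply: nearW => y /gf.
by apply: cvg_trans (cg x Ex); apply: cvg_app; apply: within_subset DE.
Qed.

Lemma extension_continuous_at {T U : topologicalType} (D E : set T) (f : T -> U) :
  open D -> D `<=` E -> extends_continuously D E f ->
  forall x, D x -> {for x, continuous f}.
Proof.
move=> oD DE [g cg gf] x Dx; have := extension_cvg DE cg gf (DE _ Dx).
rewrite gf // within_interior //; move: oD; rewrite openE; exact.
Qed.

(** The function increases on some $(0,e)$, so its limit at $0$ is at most $g(s/2)<g(s)$; the
    midpoint keeps the inequality strict. The value at $0$ enters only as a limit because the ray
    starts at a possible boundary point. *)
Lemma endpoint_lt (g g1 : R -> R) (l0 : R) :
  (\forall s \near 0^'+, is_derive (s : R) 1 g (g1 s)) ->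
  (\forall s \near 0^'+, 0 < g1 s) ->
  g s @[s --> 0^'+] --> l0 ->
  \forall s \near 0^'+, l0 < g s.
Proof.
move=> dg g1pos gl0.
have : \forall s \near 0^'+, is_derive (s : R) 1 g (g1 s) /\ 0 < g1 s by near do split.
rewrite near_withinE => /nbhs_ballP[e/= e0 He].
have {}He s : 0 < s < e -> is_derive (s : R) 1 g (g1 s) /\ 0 < g1 s.
  move=> /andP[s0 se]; apply: He => //.
  by rewrite /ball/= sub0r normrN gtr0_norm.
have inc r s : 0 < r -> r < s -> s < e -> g r < g s.
  move=> r0 rs se.
  have H z : z \in `[r, s] -> is_derive (z : R) 1 g (g1 z) /\ 0 < g1 z.
    rewrite in_itv/= => /andP[rz zs]; apply: He.
    by rewrite (lt_le_trans r0)//= (le_lt_trans zs).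
  have D z : z \in `]r, s[ -> is_derive (z : R) 1 g (g1 z).
    by move=> zrs; apply: (H z _).1; apply: subset_itv_oo_cc.
  have C : {within `[r, s], continuous g}.
    by apply: derivable_within_continuous => z /H[[]].
  have [c cin E] := MVT rs D C.
  rewrite -subr_gt0 E mulr_gt0 ?subr_gt0//.
  by apply: (H c _).2; apply: subset_itv_oo_cc.
near=> s.
have s0 : 0 < s by near: s; exact: nbhs_right_gt.
have se : s < e by near: s; exact: nbhs_right_lt.
have s2s : s / 2 < s by rewrite gtr_pMr// invf_lt1// ltr1n.
have s20 : 0 < s / 2 by rewrite divr_gt0.
apply: le_lt_trans (inc (s / 2) s s20 s2s se).
apply: cvgr_to_le gl0 _; near=> r.
apply/ltW/inc; [by near: r; exact: nbhs_right_gt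
  | by near: r; exact: nbhs_right_lt | exact: lt_trans se].
Unshelve. all: by end_near. Qed.

(** If $l_1>0$, or $l_1=0$ and $l_2>0$, then [g1] is positive just right of $0$ (in the second case
    by [endpoint_lt] applied to [g1]), and [endpoint_lt] for [g] contradicts the maximum. *)
Lemma endpoint_test (g g1 g2 : R -> R) (l0 l1 l2 : R) :
  (\forall s \near 0^'+, is_derive (s : R) 1 g (g1 s)) ->
  (\forall s \near 0^'+, is_derive (s : R) 1 g1 (g2 s)) ->
  g s @[s --> 0^'+] --> l0 -> g1 s @[s --> 0^'+] --> l1 ->
  g2 s @[s --> 0^'+] --> l2 ->
  (\forall s \near 0^'+, g s <= l0) ->
  l1 <= 0 /\ (l1 = 0 -> l2 <= 0).
Proof.
move=> dg dg1 gl g1l g2l gmax.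
have noinc : ~ \forall s \near 0^'+, 0 < g1 s.
  move=> /(endpoint_lt dg)/(_ gl) H.
  have [s [a b]] := @filter_ex _ 0^'+ _ _ (filterI H gmax).
  by have := lt_le_trans a b; rewrite ltxx.
split=> [|l10].
  rewrite leNgt; apply/negP => l1pos; apply: noinc.
  exact: (cvgr_gt _ g1l).
rewrite leNgt; apply/negP => l2pos; apply: noinc.
move: g1l; rewrite l10 => g1l; apply: endpoint_lt dg1 _ g1l.
exact: (cvgr_gt _ g2l).
Qed.

End Limits.

(** * Maxima of functions with Neumann condition *)

Section BoundaryMaximum.
Context {R : realType} {n : nat}.
Implicit Types (Omega : set 'rV[R]_n) (x d p q : 'rV[R]_n) (phi : 'rV[R]_n -> R).

Lemma is_derive_lincomb {V : normedModType R} (c : 'I_n -> R) (h : 'I_n -> V -> R)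
    (dh : 'I_n -> R) (x v : V) :
  (forall i, is_derive x v (h i) (dh i)) ->
  is_derive x v (fun y => \sum_i c i * h i y) (\sum_i c i * dh i).
Proof.
move=> H.
have -> : (fun y => \sum_i c i * h i y) = \sum_i (c i *: h i).
  by apply/funext => y; rewrite fct_sumE.
by apply: is_derive_sum => i; exact: is_deriveZ.
Qed.

Lemma C2_closure_derive Omega phi x d : open Omega -> C2_closure Omega phi ->
  Omega x -> is_derive x d phi (\sum_i d 0 i * partial i phi x).
Proof.
move=> oO [_ D1 D2 E1 E2] Ox; apply: partial_is_derive.
  by near=> y => i; apply: D1; near: y; exact: open_nbhs_nbhs.
move=> i; exact: (extension_continuous_at oO (@subset_closure _ _) (E1 i)).
Unshelve. all: by end_near. Qed.

Lemma C2_closure_derive_partial Omega phi x d j : open Omega ->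
  C2_closure Omega phi -> Omega x ->
  is_derive x d (partial j phi) (\sum_i d 0 i * partial i (partial j phi) x).
Proof.
move=> oO [_ D1 D2 E1 E2] Ox; apply: partial_is_derive.
  by near=> y => i; apply: D2; near: y; exact: open_nbhs_nbhs.
move=> i; exact: (extension_continuous_at oO (@subset_closure _ _) (E2 i j)).
Unshelve. all: by end_near. Qed.

Lemma C2_closure_cvg Omega phi x : C2_closure Omega phi -> closure Omega x ->
  phi y @[y --> within Omega (nbhs x)] --> phi x.
Proof.
move=> [c0 _ _ _ _] cx.
exact: (extension_cvg (@subset_closure _ _) c0).
Qed.

Lemma extension_cvg_lim Omega phi x :
  extends_continuously Omega (closure Omega) phi -> closure Omega x ->
  phi y @[y --> within Omega (nbhs x)] --> lim (phi y @[y --> within Omega (nbhs x)]).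
Proof.
move=> [g cg gf] cx; have H := extension_cvg (@subset_closure _ _) cg gf cx.
by apply/cvg_ex; exists (g x).
Qed.

Lemma ray_cvg x d : x + s *: d @[s --> (0 : R)] --> x.
Proof.
rewrite -[X in _ --> X]addr0; apply: cvgD; first exact: cvg_cst.
by rewrite -[X in _ --> X](scale0r d); apply: cvgZr_tmp; exact: cvg_id.
Qed.

Definition inward Omega x d := \forall s \near (0 : R)^'+, Omega (x + s *: d).

Lemma inward_interior Omega x d : open Omega -> Omega x -> inward Omega x d.
Proof.
move=> oO Ox; rewrite /inward; apply: (cvg_at_right_filter (@ray_cvg x d)).
exact: open_nbhs_nbhs.
Qed.

Lemma inward_cvg Omega x d : inward Omega x d ->
  x + s *: d @[s --> (0 : R)^'+] --> within Omega (nbhs x).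
Proof.
move=> iO A; rewrite /= !near_simpl near_withinE => OA.
have := cvg_at_right_filter (@ray_cvg x d) OA.
by move=> H; apply: filterS2 iO H => s Os; apply.
Qed.

(** This is [endpoint_test] along the ray $x+sd$, where the first and second derivatives of [phi]
    tend to $d\cdot p$ and to the quadratic form of [H] at $d$. *)
Lemma max_inward Omega phi x d p (H : 'M[R]_n) :
  open Omega -> C2_closure Omega phi -> closure Omega x ->
  (forall y, Omega y -> phi y <= phi x) ->
  (forall i, partial i phi y @[y --> within Omega (nbhs x)] --> p 0 i) ->
  (forall i j, partial i (partial j phi) y @[y --> within Omega (nbhs x)] --> H i j) ->
  inward Omega x d ->
  \sum_i d 0 i * p 0 i <= 0 /\
  (\sum_i d 0 i * p 0 i = 0 -> \sum_j d 0 j * (\sum_i d 0 i * H i j) <= 0).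
Proof.
move=> oO c2 cx mx hp hH inw.
have rc := inward_cvg inw.
apply: (@endpoint_test R (fun s => phi (x + s *: d))
  (fun s => \sum_i d 0 i * partial i phi (x + s *: d))
  (fun s => \sum_j d 0 j * (\sum_i d 0 i * partial i (partial j phi) (x + s *: d)))
  (phi x)).
- apply: filterS inw => s Os; apply: is_derive_line.
  exact: C2_closure_derive oO c2 Os.
- apply: filterS inw => s Os; apply: (@is_derive_line _ _
    (fun y => \sum_i d 0 i * partial i phi y)).
  by apply: is_derive_lincomb => j; exact: C2_closure_derive_partial oO c2 Os.
- exact: (cvg_comp _ _ rc (C2_closure_cvg c2 cx)).
- apply: cvg_sumr => i; apply: cvgMl_tmp; exact: (cvg_comp _ _ rc (hp i)).
- apply: cvg_sumr => j; apply: cvgMl_tmp; apply: cvg_sumr => i; apply: cvgMl_tmp.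
  exact: (cvg_comp _ _ rc (hH i j)).
- by apply: filterS inw => s Os; exact: mx.
Qed.

(** As a limit of negative values [rho x] is at most $0$, and a negative slope along $d$ then makes
    [rho] negative at the start of the ray. *)
Lemma inward_boundary Omega x d rho : open Omega -> boundary Omega x ->
  local_defining_function Omega x rho ->
  \sum_i d 0 i * partial i rho x < 0 -> inward Omega x d.
Proof.
move=> oO [cx nx] [U [oU Ux sm HU _]] lt0.
have Unear : nbhs x U by exact: open_nbhs_nbhs.
have drho : is_derive x d rho (\sum_i d 0 i * partial i rho x).
  apply: partial_is_derive.
    by apply: filterS Unear => y Uy i; exact: (sm [::] y Uy).2.
  by move=> i; exact: (sm [:: i] x Ux).1.
have rx0 : rho x <= 0.
  have ProperF : ProperFilter (within Omega (nbhs x)) by exact: within_nbhs_proper.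
  have crho : rho y @[y --> within Omega (nbhs x)] --> rho x.
    by apply: cvg_within_filter; exact: (sm [::] x Ux).1.
  apply: cvgr_to_le crho _; rewrite near_withinE.
  by apply: filterS Unear => y Uy Oy; apply/ltW/HU.
have [dx Ex] := drho.
have : (fun h : R => h^-1 *: ((rho \o shift x) (h *: d) - rho x)) @ 0^'
    --> \sum_i d 0 i * partial i rho x.
  by rewrite -Ex.
move=> /(cvgr_lt _)/(_ _ lt0); rewrite near_withinE => quot.
have UU : \forall s \near (0 : R)^'+, U (x + s *: d).
  by apply: (cvg_at_right_filter (@ray_cvg x d)).
rewrite /inward; near=> s.
have s0 : 0 < s by near: s; exact: nbhs_right_gt.
have Us : U (x + s *: d) by near: s.
apply/HU => //.
have : s^-1 *: ((rho \o shift x) (s *: d) - rho x) < 0.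
  have : s != 0 by rewrite gt_eqF.
  by near: s; exact: (cvg_within _ quot).
rewrite /= [s *: d + x]addrC pmulr_rlt0 ?invr_gt0// subr_lt0 => H.
exact: lt_le_trans H rx0.
Unshelve. all: by end_near. Qed.
End BoundaryMaximum.

Section MaximumPrinciple.
Context {R : realType} {n : nat}.
Implicit Types (Omega : set 'rV[R]_n) (x d p q : 'rV[R]_n) (phi : 'rV[R]_n -> R).

Lemma sqsum_gt0 q : q != 0 -> 0 < \sum_i q 0 i ^+ 2.
Proof.
move=> q0; rewrite lt_neqAle sumr_ge0 ?andbT; last by move=> i _; exact: sqr_ge0.
apply: contra q0 => /eqP/esym/psumr_eq0P H; apply/eqP/rowP => i; rewrite mxE.
by apply/eqP; rewrite -sqrf_eq0 H// => j _; exact: sqr_ge0.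
Qed.

(* At a boundary point the Neumann condition makes the gradient [p] tangential,
   and testing with the inward direction [p - q], [q] the gradient of a defining
   function, gives [|p|^2 <= 0]. *)
Lemma max_critical Omega phi x p (k : 'I_n) :
  smooth_bounded_domain Omega -> C2_closure Omega phi ->
  neumann_condition Omega phi -> closure Omega x ->
  (forall d, inward Omega x d -> \sum_i d 0 i * p 0 i <= 0) ->
  (forall i, partial i phi y @[y --> within Omega (nbhs x)] --> p 0 i) ->
  p = 0 /\ exists2 q : 'rV[R]_n, q != 0 &
    forall d, \sum_i d 0 i * q 0 i < 0 -> inward Omega x d.
Proof.
move=> [oO _ _ _ HO] c2 neu cx pin hp.
have p_eq0 : \sum_i p 0 i ^+ 2 <= 0 -> p = 0.
  by move=> ple; apply/eqP; apply: contraTT ple => /sqsum_gt0; rewrite ltNge.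
have [Ox|nOx] := pselect (Omega x).
  split; first by apply/p_eq0/(pin p)/inward_interior.
  (* At an interior point every direction is inward, so any nonzero vector can play the role of [q];
     the index [k] supplies one. *)
  exists (basis_vector k); last by move=> d _; exact: inward_interior.
  apply/eqP => /rowP/(_ k); rewrite !mxE !eqxx /= => /eqP.
  by rewrite oner_eq0.
have bx : boundary Omega x by split=> // /interior_subset.
have [rho Hrho] := HO x bx; pose q := gradient rho x.
have q0 : q != 0 by case: Hrho => U [_ Ux _ _]; apply.
have qin d : \sum_i d 0 i * q 0 i < 0 -> inward Omega x d.
  move=> dq; apply: (inward_boundary oO bx Hrho).
  suff -> : \sum_i d 0 i * partial i rho x = \sum_i d 0 i * q 0 i by [].
  by apply: eq_bigr => i _; rewrite mxE.
split; last by exists q.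
have qp : \sum_i q 0 i * p 0 i = 0.
  have ProperF : ProperFilter (within Omega (nbhs x)) by exact: within_nbhs_proper.
  have := neu x _ bx (ex_intro2 _ _ rho Hrho erefl).
  rewrite /normal_derivative -/q.
  under eq_bigr => i _ do rewrite mxE (cvg_lim _ (hp i))// -mulrA.
  rewrite -mulr_sumr => /eqP; rewrite mulf_eq0 invr_eq0 => /predU1P[|/eqP//].
  by move=> /eqP; rewrite /euclidean_norm sqrtr_eq0 leNgt sqsum_gt0.
have dq : \sum_i (p - q) 0 i * q 0 i < 0.
  rewrite (eq_bigr (fun i => q 0 i * p 0 i - q 0 i ^+ 2)); last first.
    by move=> i _; rewrite mxE [X in _ + X]mxE mulrBl [p 0 i * _]mulrC expr2.
  by rewrite sumrB qp sub0r oppr_lt0; exact: sqsum_gt0.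
apply: p_eq0; have := pin _ (qin _ dq).
rewrite (eq_bigr (fun i => p 0 i ^+ 2 - q 0 i * p 0 i)); last first.
  by move=> i _; rewrite mxE [X in _ + X]mxE mulrBl expr2.
by rewrite sumrB qp subr0.
Qed.

(** The direction $\pm e_k$ may be tangential, hence not inward. The sign [s] is chosen so that $s
    e_k$ does not point outward, and subtracting $e q$ makes it strictly inward for every $e>0$.
    Since the gradient vanishes, the second-order test applies to $s e_k-e q$; letting $e\to0$
    yields it for $s e_k$, and the sign disappears in the quadratic form. *)
Lemma max_hessian_diag Omega phi x p (H : 'M[R]_n) (k : 'I_n) :
  smooth_bounded_domain Omega -> C2_closure Omega phi ->
  neumann_condition Omega phi -> closure Omega x ->
  (forall y, Omega y -> phi y <= phi x) ->
  (forall i, partial i phi y @[y --> within Omega (nbhs x)] --> p 0 i) ->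
  (forall i j, partial i (partial j phi) y @[y --> within Omega (nbhs x)] --> H i j) ->
  H k k <= 0.
Proof.
move=> sO c2 neu cx mx hp hH; have [oO _ _ _ _] := sO.
have test d := max_inward oO c2 cx mx hp hH (d := d).
have [p0 [q q0 qin]] := max_critical k sO c2 neu cx (fun d h => (test d h).1) hp.
have sq := sqsum_gt0 q0.
pose s : R := if q 0 k <= 0 then 1 else -1.
have s2 : s * s = 1 by rewrite /s; case: ifP; rewrite ?mulr1// mulrNN mulr1.
have sq0 : s * q 0 k <= 0.
  rewrite /s; case: ifPn => [|nq]; first by rewrite mul1r.
  by rewrite mulN1r oppr_le0 ltW// ltNge.
pose d (e : R) := s *: basis_vector k + e *: (- q).
pose Q (v : 'rV[R]_n) := \sum_j v 0 j * (\sum_i v 0 i * H i j).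
have Qd : Q (d e) @[e --> (0 : R)^'+] --> Q (s *: basis_vector k).
  have dc := cvg_at_right_filter (@ray_cvg _ _ (s *: basis_vector k) (- q)).
  have dci i : d e 0 i @[e --> (0 : R)^'+] --> (s *: basis_vector k : 'rV[R]_n) 0 i.
    exact: (cvg_comp _ _ dc (@coord_continuous _ _ _ 0 i _)).
  apply: cvg_sumr => j; apply: cvgM; first exact: dci.
  by apply: cvg_sumr => i; apply: cvgMr_tmp; exact: dci.
have <- : Q (s *: basis_vector k) = H k k.
  rewrite /Q (bigD1 k)//= [X in _ + X]big1 => [|j /negbTE jk]; last first.
    by rewrite !mxE jk andbF mulr0 mul0r.
  rewrite addr0 (bigD1 k)//= big1 => [|j /negbTE jk]; last first.
    by rewrite !mxE jk andbF mulr0 mul0r.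
  by rewrite !mxE !eqxx mulr1 addr0 mulrA s2 mul1r.
apply: cvgr_to_le Qd _; near=> e.
have e0 : 0 < e by near: e; exact: nbhs_right_gt.
have [] := test (d e).
  apply: qin.
  rewrite (eq_bigr (fun i => s * (basis_vector k 0 i * q 0 i) - e * q 0 i ^+ 2)); last first.
    by move=> i _; rewrite !mxE mulrDl mulrN mulNr !mulrA.
  rewrite sumrB -!mulr_sumr (bigD1 k)//= big1 => [|j /negbTE jk]; last first.
    by rewrite !mxE jk andbF mul0r.
  rewrite !mxE !eqxx mul1r addr0 subr_lt0; apply: le_lt_trans sq0 _.
  by rewrite mulr_gt0.
move=> _; apply.
by rewrite p0 big1// => i _; rewrite [X in _ * X]mxE mulr0.
Unshelve. all: by end_near. Qed.

(** At a boundary point only limits of second derivatives from inside are available, hence the form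
    with [e]: the Laplacian tends to the trace of the limit Hessian, whose diagonal entries are
    nonpositive. *)
Lemma max_laplacian Omega phi x :
  smooth_bounded_domain Omega -> C2_closure Omega phi ->
  neumann_condition Omega phi -> closure Omega x ->
  (forall y, Omega y -> phi y <= phi x) ->
  forall e, 0 < e -> \forall y \near within Omega (nbhs x), laplacian phi y < e.
Proof.
move=> sO c2 neu cx mx e e0; have [_ _ _ E1 E2] := c2.
pose lm (f : 'rV[R]_n -> R) := lim (f y @[y --> within Omega (nbhs x)]).
pose p : 'rV[R]_n := \row_i lm (partial i phi).
pose H : 'M[R]_n := \matrix_(i, j) lm (partial i (partial j phi)).
have hp i : partial i phi y @[y --> within Omega (nbhs x)] --> p 0 i.
  by rewrite mxE; exact: extension_cvg_lim.
have hH i j : partial i (partial j phi) y @[y --> within Omega (nbhs x)] --> H i j.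
  by rewrite mxE; exact: extension_cvg_lim.
apply: (cvgr_lt (\sum_i H i i)); first by apply: cvg_sumr => i; exact: hH.
apply: le_lt_trans e0; apply: sumr_le0 => i _.
exact: max_hessian_diag sO c2 neu cx mx hp hH.
Qed.

Lemma closure_compact Omega : bounded_set Omega -> compact (closure Omega).
Proof.
move=> [M [Mr MO]]; apply: bounded_closed_compact; last exact: closed_closure.
exists M; split=> // r /MO rO x cx.
have ProperF : ProperFilter (within Omega (nbhs x)) by exact: within_nbhs_proper.
have : `|y| @[y --> within Omega (nbhs x)] --> `|x|.
  by apply: cvg_norm; exact: cvg_within.
move=> /cvgr_to_le; apply; rewrite near_withinE.
by apply: nearW => y; exact: rO.
Qed.

(** Near a maximum point over the compact closure the Laplacian is below any $e>0$, so $\phi\le C+e$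
    there, and this passes to the maximum itself. Nonconstant barriers are treated by subtracting
    them first. *)
Lemma elliptic_comparison Omega phi (C : R) :
  smooth_bounded_domain Omega -> C2_closure Omega phi ->
  neumann_condition Omega phi ->
  (forall x, Omega x -> phi x - laplacian phi x <= C) ->
  forall x, Omega x -> phi x <= C.
Proof.
move=> sO c2 neu HC; have [oO _ [x0 Ox0] bO _] := sO.
have c0 : {within closure Omega, continuous phi} by case: c2.
have [||x /set_mem cx mx] := @EVT_max_rV R n phi (closure Omega) _ _ c0.
- by exists x0; exact: subset_closure.
- exact: closure_compact.
have mxO y : Omega y -> phi y <= phi x by move=> Oy; apply/mx/mem_set/subset_closure.
move=> y Oy; apply: (le_trans (mxO y Oy)); apply/ler_addgt0Pr => e e0.
have ProperF : ProperFilter (within Omega (nbhs x)) by exact: within_nbhs_proper.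
apply: cvgr_to_le (C2_closure_cvg c2 cx) _.
have L := max_laplacian sO c2 neu cx mxO e0.
near=> z.
have Oz : Omega z by near: z; exact: near_withinT.
have Lz : laplacian phi z < e by near: z.
by have := HC z Oz; rewrite lerBlDr => /le_trans; apply; rewrite lerD2l ltW.
Unshelve. all: by end_near. Qed.
End MaximumPrinciple.

(** * Algebra of C^2 functions up to the boundary *)

Section Extensions.
Context {R : realType} {T : topologicalType}.
Implicit Types (D E : set T) (f g : T -> R).

Lemma extends_continuously_self D E f : {within E, continuous f} ->
  extends_continuously D E f.
Proof. by move=> cf; exists f. Qed.

Lemma extends_continuously_eq D E f g : (forall x, D x -> f x = g x) ->
  extends_continuously D E f -> extends_continuously D E g.
Proof. by move=> fg [h ch hf]; exists h => // x Dx; rewrite hf// fg. Qed.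

Lemma extends_continuouslyD D E f g :
  extends_continuously D E f -> extends_continuously D E g ->
  extends_continuously D E (fun x => f x + g x).
Proof.
move=> [f' cf ff] [g' cg gg]; exists (fun x => f' x + g' x).
  by move=> x; apply: cvgD; [exact: cf | exact: cg].
by move=> x Dx; rewrite ff// gg.
Qed.

Lemma extends_continuouslyM D E f g :
  extends_continuously D E f -> extends_continuously D E g ->
  extends_continuously D E (fun x => f x * g x).
Proof.
move=> [f' cf ff] [g' cg gg]; exists (fun x => f' x * g' x).
  by move=> x; apply: cvgM; [exact: cf | exact: cg].
by move=> x Dx; rewrite ff// gg.
Qed.

Lemma extends_continuously_cst D E (c : R) : extends_continuously D E (fun=> c).
Proof. by apply: extends_continuously_self => x; exact: cvg_cst. Qed.

Lemma within_continuous_comp_real E (h : R -> R) f : continuous h ->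
  {within E, continuous f} -> {within E, continuous (fun x => h (f x))}.
Proof.
move=> ch cf x; have := cvg_comp _ _ (cf x) (ch (f x)); exact.
Qed.

End Extensions.

Section C2Algebra.
Context {R : realType} {n : nat}.
Implicit Types (Omega : set 'rV[R]_n) (f g phi : 'rV[R]_n -> R).

Lemma partial_eq_on Omega f g i x : open Omega -> Omega x ->
  (forall y, Omega y -> f y = g y) -> partial i f x = partial i g x.
Proof.
move=> oO Ox fg; apply: near_eq_derive; near=> y; apply: fg.
by near: y; exact: open_nbhs_nbhs.
Unshelve. all: by end_near. Qed.

Lemma laplacian_eq_on Omega f g x : open Omega -> Omega x ->
  (forall y, Omega y -> f y = g y) -> laplacian f x = laplacian g x.
Proof.
move=> oO Ox fg; apply: eq_bigr => i _; apply: (partial_eq_on i oO Ox) => y Oy.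
exact: (partial_eq_on i oO Oy).
Qed.

(** Derivatives may be supplied as formulas [p] and [H]; openness of $\Omega$ lets [partial j phi]
    inherit the derivatives of [p j]. *)
Lemma C2_closure_intro Omega phi (p : 'I_n -> 'rV[R]_n -> R)
    (H : 'I_n -> 'I_n -> 'rV[R]_n -> R) :
  open Omega -> {within closure Omega, continuous phi} ->
  (forall i x, Omega x -> is_derive x (basis_vector i) phi (p i x)) ->
  (forall i j x, Omega x -> is_derive x (basis_vector i) (p j) (H i j x)) ->
  (forall i, extends_continuously Omega (closure Omega) (p i)) ->
  (forall i j, extends_continuously Omega (closure Omega) (H i j)) ->
  [/\ C2_closure Omega phi,
      forall i x, Omega x -> partial i phi x = p i x &
      forall i j x, Omega x -> partial i (partial j phi) x = H i j x].
Proof.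
move=> oO c0 d1 d2 e1 e2.
have P1 i x : Omega x -> partial i phi x = p i x by move=> /(d1 i)[].
have P2 i j x : Omega x -> partial i (partial j phi) x = H i j x.
  move=> Ox; rewrite (partial_eq_on i oO Ox (P1 j)).
  by case: (d2 i j x Ox).
split=> //; split=> //.
- by move=> i x /(d1 i)[].
- move=> i j x Ox; apply: (@near_eq_derivable _ _ _ (p j)); last by case: (d2 i j x Ox).
  near=> y; apply/esym/P1; near: y; exact: open_nbhs_nbhs.
- by move=> i; apply: extends_continuously_eq (e1 i) => x /P1.
- by move=> i j; apply: extends_continuously_eq (e2 i j) => x /P2.
Unshelve. all: by end_near. Qed.

Lemma C2_closure_is_derive Omega phi i x : C2_closure Omega phi -> Omega x ->
  is_derive x (basis_vector i) phi (partial i phi x).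
Proof. by move=> [_ D1 _ _ _] Ox; apply: derivableP; exact: D1. Qed.

Lemma C2_closure_is_derive2 Omega phi i j x : C2_closure Omega phi -> Omega x ->
  is_derive x (basis_vector i) (partial j phi) (partial i (partial j phi) x).
Proof. by move=> [_ _ D2 _ _] Ox; apply: derivableP; exact: D2. Qed.

(** Linear combinations, products and compositions all have a gradient of this shape, so one passage
    to the boundary serves them all; the coefficients must be continuous up to the boundary to pass
    to the limit. *)
Lemma neumann_comb Omega phi f g (a b : 'rV[R]_n -> R) :
  open Omega -> C2_closure Omega f -> C2_closure Omega g ->
  {within closure Omega, continuous a} -> {within closure Omega, continuous b} ->
  (forall i x, Omega x ->
     partial i phi x = a x * partial i f x + b x * partial i g x) ->
  neumann_condition Omega f -> neumann_condition Omega g ->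
  neumann_condition Omega phi.
Proof.
move=> oO [_ _ _ ef _] [_ _ _ eg _] ca cb E nf ng x nu bx hnu.
have [cx _] := bx.
have ProperF : ProperFilter (within Omega (nbhs x)) by exact: within_nbhs_proper.
have sub := @subset_closure _ Omega.
have la := extension_cvg sub ca (fun _ _ => erefl) cx.
have lb := extension_cvg sub cb (fun _ _ => erefl) cx.
pose lf i := lim (partial i f y @[y --> within Omega (nbhs x)]).
pose lg i := lim (partial i g y @[y --> within Omega (nbhs x)]).
have L i : lim (partial i phi y @[y --> within Omega (nbhs x)]) =
    a x * lf i + b x * lg i.
  apply: cvg_lim => //.
  apply: cvg_trans (_ : a y * partial i f y + b y * partial i g y
                        @[y --> within Omega (nbhs x)] --> _).
    apply: near_eq_cvg; rewrite near_withinE; apply: nearW => y Oy.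
    by rewrite E.
  apply: cvgD; apply: cvgM; [exact: la| |exact: lb|].
    exact: (extension_cvg_lim (ef i) cx).
  exact: (extension_cvg_lim (eg i) cx).
have Hf : \sum_i nu 0 i * lf i = 0 by exact: nf x nu bx hnu.
have Hg : \sum_i nu 0 i * lg i = 0 by exact: ng x nu bx hnu.
transitivity (\sum_i nu 0 i * (a x * lf i + b x * lg i)).
  by apply: eq_bigr => i _; rewrite L.
clear -Hf Hg; clearbody lf lg.
rewrite (eq_bigr (fun i => a x * (nu 0 i * lf i) + b x * (nu 0 i * lg i))).
  by rewrite big_split/= -!mulr_sumr Hf Hg !mulr0 addr0.
by move=> i _; rewrite mulrDr mulrCA [X in _ + X]mulrCA.
Qed.

Lemma C2_closure_cst Omega (c : R) : open Omega -> C2_closure Omega (fun=> c).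
Proof.
move=> oO; have [] := @C2_closure_intro Omega (fun=> c) (fun _ _ => 0)
    (fun _ _ _ => 0) oO => //.
- by move=> x; exact: cvg_cst.
- by move=> i; exact: extends_continuously_cst.
- by move=> i j; exact: extends_continuously_cst.
Qed.

Lemma partial_cst i (c : R) : partial i (fun=> c) = (fun=> 0 : R) :> ('rV[R]_n -> R).
Proof. by apply/funext => x; exact: derive_cst. Qed.

Lemma neumann_cst Omega (c : R) : neumann_condition Omega (fun=> c).
Proof.
move=> x nu [cx _] _; rewrite /normal_derivative big1// => i _.
have ProperF : ProperFilter (within Omega (nbhs x)) by exact: within_nbhs_proper.
rewrite partial_cst (cvg_lim _ (cvg_cst _)) ?mulr0//.
Qed.

Lemma laplacian_cst (c : R) (x : 'rV[R]_n) : laplacian (fun=> c) x = 0.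
Proof. by rewrite /laplacian big1// => i _; rewrite !partial_cst. Qed.

Lemma C2_closure_lincomb Omega f g (a b : R) : open Omega ->
  C2_closure Omega f -> C2_closure Omega g ->
  [/\ C2_closure Omega (fun x => a * f x + b * g x),
      forall i x, Omega x -> partial i (fun x => a * f x + b * g x) x =
        a * partial i f x + b * partial i g x &
      forall i j x, Omega x -> partial i (partial j (fun x => a * f x + b * g x)) x =
        a * partial i (partial j f) x + b * partial i (partial j g) x].
Proof.
move=> oO c2f c2g; have [cf _ _ ef1 ef2] := c2f; have [cg _ _ eg1 eg2] := c2g.
have der (u v : 'rV[R]_n -> R) x i du dv :
    is_derive x (basis_vector i) u du -> is_derive x (basis_vector i) v dv ->
    is_derive x (basis_vector i) (fun x => a * u x + b * v x) (a * du + b * dv).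
  by move=> hu hv; apply: is_deriveD; exact: is_deriveZ.
have ext (u v : 'rV[R]_n -> R) :
    extends_continuously Omega (closure Omega) u ->
    extends_continuously Omega (closure Omega) v ->
    extends_continuously Omega (closure Omega) (fun x => a * u x + b * v x).
  move=> hu hv; apply: extends_continuouslyD; apply: extends_continuouslyM => //;
  exact: extends_continuously_cst.
apply: C2_closure_intro => //.
- by move=> x; apply: cvgD; apply: cvgMl_tmp; [exact: cf|exact: cg].
- move=> i x Ox.
  exact: der (C2_closure_is_derive i c2f Ox) (C2_closure_is_derive i c2g Ox).
- move=> i j x Ox.
  exact: der (C2_closure_is_derive2 i j c2f Ox) (C2_closure_is_derive2 i j c2g Ox).
- by move=> i; exact: ext (ef1 i) (eg1 i).
- by move=> i j; exact: ext (ef2 i j) (eg2 i j).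
Qed.

Lemma neumann_lincomb Omega f g (a b : R) : open Omega ->
  C2_closure Omega f -> C2_closure Omega g ->
  neumann_condition Omega f -> neumann_condition Omega g ->
  neumann_condition Omega (fun x => a * f x + b * g x).
Proof.
move=> oO c2f c2g; have [_ E _] := C2_closure_lincomb a b oO c2f c2g.
by apply: (neumann_comb oO c2f c2g _ _ E) => x; exact: cvg_cst.
Qed.

Lemma laplacian_lincomb Omega f g (a b : R) x : open Omega ->
  C2_closure Omega f -> C2_closure Omega g -> Omega x ->
  laplacian (fun x => a * f x + b * g x) x = a * laplacian f x + b * laplacian g x.
Proof.
move=> oO c2f c2g Ox; have [_ _ E] := C2_closure_lincomb a b oO c2f c2g.
rewrite /laplacian !mulr_sumr -big_split; apply: eq_bigr => i _; exact: E.
Qed.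

Lemma C2_closureM Omega f g : open Omega ->
  C2_closure Omega f -> C2_closure Omega g ->
  [/\ C2_closure Omega (fun x => f x * g x) &
      forall i x, Omega x -> partial i (fun x => f x * g x) x =
        f x * partial i g x + g x * partial i f x].
Proof.
move=> oO c2f c2g; have [cf _ _ ef1 ef2] := c2f; have [cg _ _ eg1 eg2] := c2g.
have sf := extends_continuously_self Omega cf.
have sg := extends_continuously_self Omega cg.
have [] // := @C2_closure_intro Omega (fun x => f x * g x)
   (fun i x => f x * partial i g x + g x * partial i f x)
   (fun i j x => (f x * partial i (partial j g) x + partial j g x * partial i f x) +
                 (g x * partial i (partial j f) x + partial j f x * partial i g x)) oO.
- by move=> x; apply: cvgM; [exact: cf|exact: cg].
- move=> i x Ox; have Df := C2_closure_is_derive i c2f Ox.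
  have Dg := C2_closure_is_derive i c2g Ox; exact: is_deriveM.
- move=> i j x Ox; have Df := C2_closure_is_derive i c2f Ox.
  have Dg := C2_closure_is_derive i c2g Ox.
  have Df2 := C2_closure_is_derive2 i j c2f Ox.
  have Dg2 := C2_closure_is_derive2 i j c2g Ox.
  by apply: is_deriveD; exact: is_deriveM.
- by move=> i; apply: extends_continuouslyD; exact: extends_continuouslyM.
- by move=> i j; apply: extends_continuouslyD; apply: extends_continuouslyD;
    exact: extends_continuouslyM.
Qed.

Lemma neumannM Omega f g : open Omega ->
  C2_closure Omega f -> C2_closure Omega g ->
  neumann_condition Omega f -> neumann_condition Omega g ->
  neumann_condition Omega (fun x => f x * g x).
Proof.
move=> oO c2f c2g nf ng; have [_ E] := C2_closureM oO c2f c2g.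
have [cf _ _ _ _] := c2f; have [cg _ _ _ _] := c2g.
exact: (neumann_comb oO c2g c2f cf cg E ng nf).
Qed.

Lemma is_derive_comp_real {V : normedModType R} (h : R -> R) (f : V -> R) (x d : V)
    (l h' : R) :
  is_derive (f x) 1 h h' -> is_derive x d f l ->
  is_derive x d (fun y => h (f y)) (h' * l).
Proof.
move=> dh df; apply: is_derive_from_line.
have L : is_derive (0 : R) 1 (fun r => f (x + r *: d)) l.
  by apply: is_derive_line; rewrite scale0r addr0.
apply: (@is_derive1_comp _ h (fun r => f (x + r *: d))) => //.
by rewrite scale0r addr0.
Qed.

Lemma C2_closure_comp Omega (h h1 h2 : R -> R) f : open Omega ->
  (forall s : R, is_derive s 1 h (h1 s)) -> (forall s : R, is_derive s 1 h1 (h2 s)) ->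
  continuous h2 -> C2_closure Omega f ->
  [/\ C2_closure Omega (fun x => h (f x)) &
      forall i x, Omega x -> partial i (fun x => h (f x)) x = h1 (f x) * partial i f x].
Proof.
move=> oO dh dh1 ch2 c2f; have [cf _ _ ef1 ef2] := c2f.
have ch : continuous h.
  by move=> s; apply/differentiable_continuous/derivable1_diffP; case: (dh s).
have ch1 : continuous h1.
  by move=> s; apply/differentiable_continuous/derivable1_diffP; case: (dh1 s).
have ext (k : R -> R) : continuous k -> extends_continuously Omega (closure Omega) (fun x => k (f x)).
  by move=> ck; apply: extends_continuously_self; exact: within_continuous_comp_real.
have [] // := @C2_closure_intro Omega (fun x => h (f x))
   (fun i x => h1 (f x) * partial i f x)
   (fun i j x => h1 (f x) * partial i (partial j f) x +
                 partial j f x * (h2 (f x) * partial i f x)) oO.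
- exact: within_continuous_comp_real.
- move=> i x Ox; apply: is_derive_comp_real => //; exact: C2_closure_is_derive c2f Ox.
- move=> i j x Ox; apply: is_deriveM.
    by apply: is_derive_comp_real => //; exact: C2_closure_is_derive c2f Ox.
  exact: C2_closure_is_derive2 c2f Ox.
- by move=> i; apply: extends_continuouslyM => //; exact: ext.
- move=> i j; apply: extends_continuouslyD; apply: extends_continuouslyM => //.
    exact: ext.
  by apply: extends_continuouslyM => //; exact: ext.
Qed.

Lemma neumann_comp Omega (h h1 h2 : R -> R) f : open Omega ->
  (forall s : R, is_derive s 1 h (h1 s)) -> (forall s : R, is_derive s 1 h1 (h2 s)) ->
  continuous h2 -> C2_closure Omega f -> neumann_condition Omega f ->
  neumann_condition Omega (fun x => h (f x)).
Proof.
move=> oO dh dh1 ch2 c2f nf; have [cf _ _ _ _] := c2f.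
have [_ E] := C2_closure_comp oO dh dh1 ch2 c2f.
have ch1 : continuous h1.
  by move=> s; apply/differentiable_continuous/derivable1_diffP; case: (dh1 s).
apply: (neumann_comb (b := fun=> 0) oO c2f c2f _ _ _ nf nf).
- exact: within_continuous_comp_real ch1 cf.
- by move=> x; exact: cvg_cst.
- by move=> i x Ox; rewrite E// mul0r addr0.
Qed.

End C2Algebra.

(** * Extension of gamma to the real line *)

Section Gluing.
Context {R : realType}.

(** By the mean value theorem the difference quotient at $0$ is a value of [f1] at a nearby nonzero
    point, and [f1] is continuous at $0$. *)
Lemma is_derive_glue (f f1 : R -> R) : continuous f -> continuous f1 ->
  (forall s : R, s != 0 -> is_derive s 1 f (f1 s)) ->
  forall s : R, is_derive s 1 f (f1 s).
Proof.
move=> cf cf1 H s; have [->|] := eqVneq s 0; last exact: H.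
have E : (fun h : R => h^-1 *: ((f \o shift (0 : R)) (h *: (1 : R)) - f 0)) @ 0^' --> f1 0.
  apply/cvgrPdist_lt => e e0.
  have : \forall y \near (0 : R), `|f1 0 - f1 y| < e.
    exact: (proj1 (cvgrPdist_lt _ _) (cf1 0)).
  move=> /nbhs_ballP[r/= r0 Hr].
  rewrite near_withinE; apply/nbhs_ballP; exists r => //= h.
  rewrite /ball/= sub0r normrN => hr h0.
  rewrite addr0 [h *: (1 : R)]mulr1.
  suff [c cr ->] : exists2 c, `|c| < r & f h - f 0 = f1 c * h.
    rewrite [_ *: _]mulrC mulfK//; apply: Hr.
    by rewrite /ball/= sub0r normrN.
  have [h0'|h0'|h0'] := ltrgtP h 0; last by rewrite h0' eqxx in h0.
  - have D (z : R) : z \in `]h, 0[ -> is_derive z 1 f (f1 z).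
      by rewrite in_itv/= => /andP[_ z0]; apply: H; rewrite lt_eqF.
    have [c] := MVT h0' D (continuous_subspaceT cf).
    rewrite in_itv/= => /andP[hc c0]; rewrite sub0r => Ec; exists c.
      by move: hr; rewrite !ltr0_norm// => hr; apply: lt_trans hr; rewrite ltrN2.
    by rewrite -opprB Ec mulrN opprK.
  - have D (z : R) : z \in `]0, h[ -> is_derive z 1 f (f1 z).
      by rewrite in_itv/= => /andP[z0 _]; apply: H; rewrite gt_eqF.
    have [c] := MVT h0' D (continuous_subspaceT cf).
    rewrite in_itv/= => /andP[c0 hc]; rewrite subr0 => Ec; exists c => //.
    by move: hr; rewrite !gtr0_norm// => hr; apply: lt_trans hr.
split; [by apply/cvg_ex; exists (f1 0) | exact: cvg_lim].
Qed.

Lemma continuous_half_line (G : R -> R) : {within `[0, +oo[, continuous G} ->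
  continuous (fun s : R => G (Num.max s 0)).
Proof.
move=> /subspace_continuousP cG s.
have m0 : `[0, +oo[%classic (Num.max s 0).
  by rewrite /= in_itv/= andbT le_max lexx orbT.
have cm : Num.max y 0 @[y --> s] --> Num.max s 0.
  have E (y : R) : Num.max y 0 = (y + `|y|) / 2.
    case: (leP y 0) => y0; first by rewrite ler0_norm// subrr mul0r.
    by rewrite gtr0_norm// -mulr2n -[_ *+ 2]mulr_natr mulfK// pnatr_eq0.
  under eq_fun do rewrite E; rewrite E.
  apply: cvgMr_tmp; apply: cvgD; first exact: cvg_id.
  by apply: cvg_norm; exact: cvg_id.
apply: (@cvg_comp _ _ _ (fun y => Num.max y 0) G _
  (within `[0, +oo[%classic (nbhs (Num.max s 0)))); last exact: cG.
move=> A HA.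
have : \forall y \near s, `[0, +oo[%classic (Num.max y 0) -> A (Num.max y 0).
  exact: cm HA.
move=> DA; change (\forall y \near s, A (Num.max y 0)).
by apply: filterS DA => y; apply; rewrite /= in_itv/= andbT le_max lexx orbT.
Qed.

Lemma continuous_min0 : continuous (fun s : R => Num.min s 0).
Proof.
move=> s; have E (y : R) : Num.min y 0 = (y - `|y|) / 2.
  case: (leP y 0) => y0; last by rewrite gtr0_norm// subrr mul0r.
  by rewrite ler0_norm// opprK -mulr2n -[_ *+ 2]mulr_natr mulfK// pnatr_eq0.
rewrite /continuous_at; under eq_fun do rewrite E; rewrite E.
apply: cvgMr_tmp; apply: cvgB; first exact: cvg_id.
by apply: cvg_norm; exact: cvg_id.
Qed.

(** To the right of $0$ the [min] terms vanish and [g] remains; to the left stands the tangent of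
    [g] at $0$ plus a correction [k] that vanishes to first order. Both sides thus match in value
    and slope, whatever higher-order term [k] carries. *)
Lemma half_line_extension (g g1 g1' : R -> R) :
  {within `[0, +oo[, continuous g} -> {within `[0, +oo[, continuous g1} ->
  (forall s : R, 0 < s -> is_derive s 1 g (g1 s)) ->
  forall k : R -> R, (forall s : R, is_derive s 1 k (g1' s)) -> k 0 = 0 ->
  g1' 0 = 0 -> continuous g1' ->
  forall s : R, is_derive s 1
     (fun s : R => g (Num.max s 0) + g1 0 * Num.min s 0 + k (Num.min s 0))
     (g1 (Num.max s 0) + g1' (Num.min s 0)).
Proof.
move=> cg cg1 dg k dk k0 g1'0 cg1'.
have ck : continuous k.
  by move=> s; apply/differentiable_continuous/derivable1_diffP; case: (dk s).
apply: (@is_derive_glue _ (fun s => g1 (Num.max s 0) + g1' (Num.min s 0))).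
- move=> s; apply: cvgD; first apply: cvgD.
  + exact: continuous_half_line.
  + by apply: cvgMl_tmp; exact: continuous_min0.
  + exact: (cvg_comp _ _ (@continuous_min0 s) (ck _)).
- move=> s; apply: cvgD; first exact: continuous_half_line.
  exact: (cvg_comp _ _ (@continuous_min0 s) (cg1' _)).
- move=> s /lt_total/orP[s0|s0].
  + rewrite (min_idPl (ltW s0)) (max_idPr (ltW s0)).
    apply: (@near_eq_is_derive _ _ _ (fun y : R => g 0 + g1 0 * y + k y)).
      near=> y; have y0 : y < 0 by near: y; exact: lt_nbhsl.
      by rewrite (min_idPl (ltW y0)) (max_idPr (ltW y0)).
    have lin : is_derive s (1 : R) (fun y : R => g1 0 * y) (g1 0 * 1).
      exact: is_deriveZ.
    have := is_deriveD (is_deriveD (is_derive_cst (g 0) s 1) lin) (dk s).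
    by rewrite add0r mulr1.
  + rewrite (min_idPr (ltW s0)) (max_idPl (ltW s0)) g1'0 addr0.
    apply: (@near_eq_is_derive _ _ _ g); last exact: dg.
    near=> y; have y0 : 0 < y by near: y; exact: lt_nbhsr.
    by rewrite (min_idPr (ltW y0)) (max_idPl (ltW y0)) k0 mulr0 !addr0.
Unshelve. all: by end_near. Qed.

(* On the negative half line, the quadratic Taylor polynomial at [0]. *)
Lemma C3_half_line_extension (gamma : R -> R) : C3_half_line gamma ->
  exists h h1 h2 : R -> R,
    [/\ forall s : R, is_derive s 1 h (h1 s),
        forall s : R, is_derive s 1 h1 (h2 s),
        continuous h2,
        forall s, 0 <= s -> h s = gamma s &
        forall s, 0 < s -> h1 s = derive1 gamma s].
Proof.
move=> [cg dg eg].
have [G1 cG1 G1E] := eg 1%N isT; have [G2 cG2 G2E] := eg 2%N isT.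
have pos (s : R) : 0 < s -> `]0, +oo[%classic s by move=> s0; rewrite /= in_itv/= s0.
have d1 (s : R) : 0 < s -> is_derive s 1 gamma (G1 s).
  move=> s0; rewrite G1E ?derive1n1 ?derive1E; last exact: pos.
  by apply: derivableP; exact: (dg 0%N s isT s0).
have d2 (s : R) : 0 < s -> is_derive s 1 G1 (G2 s).
  move=> s0; apply: (@near_eq_is_derive _ _ _ (derive1n 1 gamma)).
    near=> y; rewrite G1E//; apply: pos; near: y; exact: lt_nbhsr.
  rewrite G2E ?derive1nS ?derive1E; last exact: pos.
  by apply: derivableP; exact: (dg 1%N s isT s0).
(* With this coefficient the derivative obtained in [D1] is exactly the function differentiated in
   [D2], so it can serve as [h1]. *)
pose c := G2 0.
have D1 : forall s : R, is_derive s 1 (fun s => gamma (Num.max s 0) + G1 0 * Num.min s 0 +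
     (fun r => c / 2 * r ^+ 2) (Num.min s 0))
     (G1 (Num.max s 0) + (fun r => c * r) (Num.min s 0)).
  apply: (@half_line_extension gamma G1 (fun r => c * r) cg cG1 d1 (fun r => c / 2 * r ^+ 2)).
  - move=> s; have := is_deriveZ (c / 2) (is_deriveX 2 (is_derive_id s (1 : R))).
    rewrite expr1 [_ *: (1 : R)]mulr1 [_ *: _]mulrA.
    by rewrite -[2%:R]/(2 : R) divfK ?pnatr_eq0.
  - by rewrite expr0n mulr0.
  - by rewrite mulr0.
  - by move=> s; apply: cvgMl_tmp; exact: cvg_id.
have D2 : forall s : R, is_derive s 1 (fun s => G1 (Num.max s 0) + G2 0 * Num.min s 0 +
     (fun=> 0) (Num.min s 0)) (G2 (Num.max s 0) + (fun=> 0) (Num.min s 0)).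
  apply: (@half_line_extension G1 G2 (fun=> 0) cG1 cG2 d2 (fun=> 0)) => //.
  by move=> s; exact: cvg_cst.
exists (fun s => gamma (Num.max s 0) + G1 0 * Num.min s 0 + c / 2 * (Num.min s 0) ^+ 2),
  (fun s => G1 (Num.max s 0) + c * Num.min s 0), (fun s => G2 (Num.max s 0)).
split.
- exact: D1.
- move=> s; have := D2 s; rewrite /= addr0; under eq_fun do rewrite addr0; exact.
- exact: continuous_half_line.
- by move=> s s0; rewrite (min_idPr s0) (max_idPl s0) expr0n !mulr0 !addr0.
- move=> s s0; rewrite (min_idPr (ltW s0)) (max_idPl (ltW s0)) mulr0 addr0 G1E//.
  exact: pos.
Unshelve. all: by end_near. Qed.

End Gluing.

(** * Functions on space-time cylinders *)

Section Cylinders.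
Context {R : realType}.

Lemma time_oo_open (T : \bar R) : open (time_oo T).
Proof.
have -> : time_oo T = [set t : R | 0 < t] `&` [set t : R | (t%:E < T)%E] by [].
apply: openI; first exact: open_gt.
case: T => [r| |].
- by rewrite (_ : [set _ | _] = [set t : R | t < r]); first exact: open_lt.
- rewrite (_ : [set _ | _] = setT); first exact: openT.
  by apply/seteqP; split => // t _ /=; rewrite ltry.
- rewrite (_ : [set _ | _] = set0); first exact: open0.
  by apply/seteqP; split.
Qed.

Lemma within_slice_left {X : topologicalType} (A : set X) (B : set R)
    (g : X * R -> R) t : B t -> {within A `*` B, continuous g} ->
  {within A, continuous (fun x => g (x, t))}.
Proof.
move=> Bt /subspace_continuousP cg; apply/subspace_continuousP => x Ax.
apply: (@cvg_comp _ _ _ (fun y => (y, t)) g _ (within (A `*` B) (nbhs (x, t)))).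
  move=> S [[U V] [/= nU nV] UV].
  change (\forall y \near x, A y -> S (y, t)); apply: filterS nU => y Uy Ay.
  by apply: (UV (y, t)); [split => //; exact: nbhs_singleton | split].
exact: (cg (x, t)).
Qed.

Lemma within_slice_right {X : topologicalType} (A : set X) (B : set R)
    (g : X * R -> R) x : A x -> {within A `*` B, continuous g} ->
  {within B, continuous (fun t => g (x, t))}.
Proof.
move=> Ax /subspace_continuousP cg; apply/subspace_continuousP => t Bt.
apply: (@cvg_comp _ _ _ (fun s => (x, s)) g _ (within (A `*` B) (nbhs (x, t)))).
  move=> S [[U V] [/= nU nV] UV].
  change (\forall s \near t, B s -> S (x, s)); apply: filterS nV => s Vs Bs.
  by apply: (UV (x, s)); [split => //; exact: nbhs_singleton | split].
exact: (cg (x, t)).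
Qed.

(** A tube argument: continuity at each $(x,t)$ gives a product neighbourhood, and compactness of
    [K] provides one time neighbourhood common to all $x$. *)
Lemma compact_slice_continuous {X : topologicalType} (K : set X) (B : set R)
    (g : X * R -> R) t e : compact K -> {within K `*` B, continuous g} ->
  B t -> 0 < e ->
  \forall s \near within B (nbhs t), forall x, K x -> `|g (x, t) - g (x, s)| < e.
Proof.
move=> cK /subspace_continuousP cg Bt e0.
have /near_covering_withinP := proj1 (compact_near_coveringP K) cK.
move=> /(_ R (within B (nbhs t)) (fun s x => `|g (x, t) - g (x, s)| < e)); apply.
move=> x Kx.
have e20 : 0 < e / 2 by rewrite divr_gt0.
have := proj1 (cvgrPdist_lt _ _) (cg (x, t) (conj Kx Bt)) _ e20.
move=> [[U V] [/= nU nV] UV].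
exists (U, V `&` B).
  by split=> //=; apply: filterI; [exact: (cvg_within _ nV) | exact: withinT].
move=> [y s] /= [Uy [Vs Bs]] Ky.
have H1 := UV (y, s) (conj Uy Vs) (conj Ky Bs).
have H2 := UV (y, t) (conj Uy (nbhs_singleton nV)) (conj Ky Bt).
rewrite /from_subspace/= in H1 H2.
by rewrite (splitr e) (le_lt_trans (ler_distD (g (x, t)) _ _))// ltrD// distrC.
Qed.

Context {n : nat}.
Implicit Types (Omega : set 'rV[R]_n) (u v : 'rV[R]_n -> R -> R).

Lemma C21_slice Omega T u t : C21_cylinder Omega T u -> time_oo T t ->
  C2_closure Omega (u ^~ t).
Proof.
move=> [c0 d _ e1 e2] Tt.
have ext (f : 'rV[R]_n -> R -> R) :
    extends_continuously (Omega `*` time_oo T) (closure Omega `*` time_oo T)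
      (fun p : 'rV[R]_n * R => f p.1 p.2) ->
    extends_continuously Omega (closure Omega) (f ^~ t).
  move=> [g cg gf]; exists (fun x => g (x, t)); first exact: within_slice_left cg.
  by move=> x Ox; exact: gf.
split.
- exact: (within_slice_left Tt c0).
- by move=> i x Ox; have [_ h _] := d x t Ox Tt; exact: h.
- by move=> i j x Ox; have [_ _ h] := d x t Ox Tt; exact: h.
- by move=> i; exact: (ext (fun x t => partial i (u ^~ t) x) (e1 i)).
- by move=> i j; exact: (ext (fun x t => partial i (partial j (u ^~ t)) x) (e2 i j)).
Qed.

Lemma C21_is_derive Omega T u x t : C21_cylinder Omega T u -> Omega x ->
  time_oo T t -> is_derive t 1 (u x) (time_derivative u x t).
Proof.
move=> [_ d _ _ _] Ox Tt; rewrite /time_derivative derive1E.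
by have [h _ _] := d x t Ox Tt; exact: derivableP h.
Qed.

(** The quotient is the time derivative at an intermediate time, and that derivative extends
    continuously to the compact closure. Uniformity in $x$ is essential: the error becomes the
    constant in a comparison over all of $\Omega$. *)
Lemma time_quotient_uniform Omega T u t e : compact (closure Omega) ->
  C21_cylinder Omega T u -> time_oo T t -> 0 < e ->
  \forall h \near (0 : R)^'+, forall x, Omega x ->
    `|h^-1 * (u x (t + h) - u x t) - time_derivative u x t| < e.
Proof.
move=> cO c21 Tt e0; have [_ _ [g cg gE] _ _] := c21.
have := compact_slice_continuous cO cg Tt e0.
have /within_interior -> : (time_oo T)^° t.
  by move: (@time_oo_open T); rewrite openE; exact.
move=> /nbhs_ballP[r1/= r10 H1].
have /nbhs_ballP[r2/= r20 H2] : \forall s \near t, time_oo T s.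
  by apply: open_nbhs_nbhs; split=> //; exact: time_oo_open.
near=> h => x Ox.
have h0 : 0 < h by near: h; exact: nbhs_right_gt.
have hr1 : h < r1 by near: h; exact: nbhs_right_lt.
have hr2 : h < r2 by near: h; exact: nbhs_right_lt.
have near_t s : t <= s <= t + h -> `|t - s| <= h.
  move=> /andP[ts sth]; rewrite distrC ger0_norm ?subr_ge0//.
  by rewrite lerBlDl.
have D (s : R) : t <= s <= t + h -> is_derive s 1 (u x) (time_derivative u x s).
  move=> /near_t ts; apply: (C21_is_derive c21 Ox); apply: H2.
  exact: le_lt_trans ts hr2.
have C : {within `[t, t + h], continuous u x}.
  by apply: derivable_within_continuous => s; rewrite in_itv/= => /D[].
have tth : t < t + h by rewrite ltrDl.
have D' (s : R) : s \in `]t, t + h[ -> is_derive s 1 (u x) (time_derivative u x s).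
  by rewrite in_itv/= => /andP[ts sth]; apply: D; rewrite !ltW.
have [c] := MVT tth D' C; rewrite in_itv/= => /andP[tc cth] ->.
have ct : `|t - c| <= h by apply: near_t; rewrite !ltW.
have Tc : time_oo T c by apply: H2; exact: le_lt_trans ct hr2.
have -> : h^-1 * (time_derivative u x c * (t + h - t)) = time_derivative u x c.
  by rewrite addrC addKr mulrC mulfK// gt_eqF.
rewrite -(gE (x, c))// -(gE (x, t))// distrC.
apply: H1; last exact: subset_closure.
exact: le_lt_trans ct hr1.
Unshelve. all: by end_near. Qed.

(** * Uniqueness for the Neumann problem $w-\Delta w=f$ *)

Let approx_sub (a1 a2 l1 l2 w1 w2 f e : R) :
  `|a1 - w1| < e -> `|l1 - (w1 - f)| < e ->
  `|a2 - w2| < e -> `|l2 - (w2 - f)| < e ->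
  1 * a1 + -1 * a2 - (1 * l1 + -1 * l2) <= 4 * e.
Proof. by rewrite !ltr_norml; lra. Qed.

Let approx_le (a1 a2 w1 w2 e : R) : `|a1 - w1| < e / 6 -> `|a2 - w2| < e / 6 ->
  1 * a1 + -1 * a2 <= 4 * (e / 6) -> w1 <= w2 + e.
Proof. by rewrite !ltr_norml; lra. Qed.

Lemma inv_I_sub_neumann_laplacian_le Omega (f w1 w2 : 'rV[R]_n -> R) :
  smooth_bounded_domain Omega ->
  neumann_laplacian Omega w1 (fun x => w1 x - f x) ->
  neumann_laplacian Omega w2 (fun x => w2 x - f x) ->
  forall x, Omega x -> w1 x <= w2 x.
Proof.
move=> sO [_ _ H1] [_ _ H2] x Ox; have [oO _ _ _ _] := sO.
apply/ler_addgt0Pr => e e0.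
(* [elliptic_comparison] needs $C^2$ functions, so it is applied to the difference of two
   approximants. Of the six errors $e/6$, four come from the values and Laplacians of [p1] and [p2],
   and two from returning to [w1] and [w2]. *)
have e60 : 0 < e / 6 by rewrite divr_gt0.
have [p1 [c1 n1 A1]] := H1 _ e60.
have [p2 [c2 n2 A2]] := H2 _ e60.
have [c _ _] := C2_closure_lincomb 1 (-1) oO c1 c2.
have nn := neumann_lincomb 1 (-1) oO c1 c2 n1 n2.
have := elliptic_comparison sO c nn (C := 4 * (e / 6)).
have Hle y : Omega y -> 1 * p1 y + -1 * p2 y -
    laplacian (fun x => 1 * p1 x + -1 * p2 x) y <= 4 * (e / 6).
  move=> Oy; rewrite (laplacian_lincomb 1 (-1) oO c1 c2 Oy).
  have [a1 l1] := A1 y Oy; have [a2 l2] := A2 y Oy.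
  exact: approx_sub a1 l1 a2 l2.
move=> /(_ Hle x Ox).
have [a1 _] := A1 x Ox; have [a2 _] := A2 x Ox.
exact: approx_le.
Qed.

(** The inverse is a choice made by [xget]; comparison in both directions identifies it with any
    solution at hand. *)
Lemma inv_I_sub_neumann_laplacianE Omega (f w : 'rV[R]_n -> R) :
  smooth_bounded_domain Omega ->
  neumann_laplacian Omega w (fun x => w x - f x) ->
  forall x, Omega x -> inv_I_sub_neumann_laplacian Omega f x = w x.
Proof.
move=> sO Hw x Ox.
have H := @xgetPex _ (fun=> 0)
    [set w | neumann_laplacian Omega w (fun x => w x - f x)] (ex_intro _ w Hw).
apply/le_anti/andP; split.
  exact: inv_I_sub_neumann_laplacian_le sO H Hw x Ox.
exact: inv_I_sub_neumann_laplacian_le sO Hw H x Ox.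
Qed.

End Cylinders.

(** * Parabolic maximum principle *)

Section ParabolicMinimum.
Context {R : realType} {n : nat}.
Implicit Types (Omega : set 'rV[R]_n) (Z : 'rV[R]_n -> R -> R).

(** The choice of [e] gives $aL\ge-Ae\ge-m/4$, while $c-K\le-1$ and $z\le-m/2$ give $(c-K)z\ge
    m/2$. *)
Let drift_bound (a c L z K m A e : R) : 0 <= a -> a <= A -> c <= K - 1 ->
  - e < L -> z <= - (m / 2) -> 0 < m -> e = m / (4 * (A + 1)) ->
  m / 4 <= a * L + c * z - K * z.
Proof.
move=> a0 aA cK Le zm m0 eE.
have A1 : 0 < A + 1 by rewrite ltr_wpDl// (le_trans a0).
have e0 : 0 <= e by rewrite eE divr_ge0 ?mulr_ge0 ?ltW.
have Ae : A * e <= m / 4.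
  have -> : m / 4 = A * e + e by rewrite eE; field; rewrite gt_eqF.
  by rewrite lerDl.
have h1 : - (A * e) <= a * L.
  apply: (@le_trans _ _ (a * (- e))); first by rewrite mulrN lerN2 ler_wpM2r.
  by rewrite ler_wpM2l// ltW.
have h2 : m / 2 <= (c - K) * z.
  have : 0 <= (K - c - 1) * (- z) by rewrite mulr_ge0//; lra.
  by rewrite (_ : (K - c - 1) * (- z) = (c - K) * z + z); [lra|ring].
have -> : a * L + c * z - K * z = a * L + (c - K) * z by ring.
lra.
Qed.

Lemma is_derive_expR_mul (K : R) (f : R -> R) (t l : R) : is_derive t 1 f l ->
  is_derive t 1 (fun s => expR (- K * s) * f s) (expR (- K * t) * (l - K * f t)).
Proof.
move=> df.
have lin : is_derive t (1 : R) (fun s : R => - K * s) (- K * 1).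
  exact: is_deriveZ.
have dexp : is_derive t (1 : R) (fun s : R => expR (- K * s)) (expR (- K * t) * (- K * 1)).
  exact: is_derive1_comp (is_derive_expR _) lin.
apply: is_derive_eq (is_deriveM dexp df) _.
rewrite mulr1 /GRing.scale/=; ring.
Qed.

Lemma is_derive_continuous (f : R -> R) (t l : R) : is_derive t 1 f l ->
  {for t, continuous f}.
Proof. by move=> [d _]; apply/differentiable_continuous/derivable1_diffP. Qed.

(* If [exp (- K t) Z] has a negative minimum at [(x0, t0)], then [Z_t - K Z] is
   positive there, so [exp (- K t) Z] was smaller at an earlier time. As [x0] may
   lie on the boundary, where [Z] has no time derivative a priori, the increase is
   computed at nearby interior points. *)
Lemma parabolic_nonneg Omega Z (Zt : 'rV[R]_n -> R -> R) (T : \bar R) (T' A C : R) :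
  smooth_bounded_domain Omega -> 0 < T' -> (T'%:E < T)%E ->
  C0_cylinder Omega T Z ->
  (forall t, time_oo T t -> C2_closure Omega (Z ^~ t)) ->
  (forall t, time_oo T t -> neumann_condition Omega (Z ^~ t)) ->
  (forall x t, Omega x -> time_oo T t -> is_derive t 1 (Z x) (Zt x t)) ->
  extends_continuously (Omega `*` time_oo T) (closure Omega `*` time_oo T)
      (fun p : 'rV[R]_n * R => Zt p.1 p.2) ->
  (forall x, Omega x -> 0 <= Z x 0) ->
  (forall x t, Omega x -> 0 < t <= T' -> exists a c,
     [/\ 0 <= a, a <= A, c <= C & Zt x t = a * laplacian (Z ^~ t) x + c * Z x t]) ->
  forall x t, Omega x -> 0 <= t <= T' -> 0 <= Z x t.
Proof.
move=> sO T'0 T'T c0 c2 neu dZ [G cG GE] Z0 eqn.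
have [oO _ [xO OxO] bO _] := sO.
have cO := closure_compact bO.
have subO := @subset_closure _ Omega.
have coT s : 0 <= s <= T' -> time_co T s.
  by move=> /andP[s0 sT]; split=> //; rewrite (le_lt_trans _ T'T)// lee_fin.
have ooT s : 0 < s <= T' -> time_oo T s.
  by move=> /andP[s0 sT]; split=> //; rewrite (le_lt_trans _ T'T)// lee_fin.
(* The summand 1 ensures $c-K\le-1$; the maximum with $0$ keeps [K] positive, so that $e^{-Ks}$
   decreases in $s$. *)
pose K := Num.max C 0 + 1.
have K0 : 0 < K by rewrite ltr_wpDl// le_max lexx orbT.
have CK c : c <= C -> c <= K - 1 by move=> cC; rewrite addrK le_max cC.
pose zeta x t := expR (- K * t) * Z x t.
have czeta : {within closure Omega `*` `[0, T'],
    continuous (fun p : 'rV[R]_n * R => zeta p.1 p.2)}.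
  move=> p; apply: cvgM.
    apply: (@continuous_subspaceT _ _ _ (fun p : 'rV[R]_n * R => expR (- K * p.2))).
    move=> q; apply: (@cvg_comp _ _ _ (fun q : 'rV[R]_n * R => - K * q.2) expR _
      (nbhs (- K * q.2))); last exact: continuous_expR.
    by apply: cvgMl_tmp; exact: cvg_snd.
  apply: (continuous_subspaceW _ c0) => -[y s] [/= cy]; rewrite in_itv/= => sT.
  by split=> //=; exact: coT.
have [||[x0 t0] /set_mem[/= cx0]] := compact_EVT_min _ _ czeta.
- exists (xO, 0); split=> /=; first exact: subO.
  by rewrite in_itv/= lexx ltW.
- by apply: compact_setX => //; exact: segment_compact.
rewrite in_itv/= => /andP[t00 t0T] minz.
have {}minz y s : closure Omega y -> 0 <= s <= T' -> zeta x0 t0 <= zeta y s.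
  by move=> cy sT; apply: (minz (y, s)); apply/mem_set; split=> //=; rewrite in_itv.
have [zpos|zneg] := leP 0 (zeta x0 t0).
  move=> x t Ox tT; have := le_trans zpos (minz x t (subO _ Ox) tT).
  by rewrite /zeta pmulr_rge0// expR_gt0.
exfalso.
have PF : ProperFilter (within Omega (nbhs x0)) by exact: within_nbhs_proper.
have slice s : time_co T s -> Z y s @[y --> within Omega (nbhs x0)] --> Z x0 s.
  move=> cs; apply: (extension_cvg subO (g := Z ^~ s)) => //.
  exact: (@within_slice_left R _ (closure Omega) (time_co T)
    (fun p : 'rV[R]_n * R => Z p.1 p.2)).
have {t00}t00 : 0 < t0.
  rewrite lt_neqAle t00 andbT; apply/negP => /eqP t0E; move: zneg.
  rewrite /zeta -t0E mulr0 expR0 mul1r ltNge => /negP; apply.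
  apply: cvgr_to_ge (slice 0 (coT _ _)) _; first by rewrite lexx ltW.
  by rewrite near_withinE; apply: nearW => y; exact: Z0.
have To : time_oo T t0 by apply: ooT; rewrite t00.
have Tc : time_co T t0 by apply: coT; rewrite (ltW t00).
pose m := - Z x0 t0.
have m0 : 0 < m.
  by move: zneg; rewrite /zeta pmulr_rlt0 ?expR_gt0// oppr_gt0.
have minZ y : Omega y -> Z x0 t0 <= Z y t0.
  move=> Oy; have := minz y t0 (subO _ Oy); rewrite (ltW t00) => /(_ t0T).
  by rewrite /zeta ler_pM2l// expR_gt0.
have A0 : 0 <= A.
  have [|a [c [a0 aA _ _]]] := eqn xO t0 OxO; first by rewrite t00.
  exact: le_trans aA.
pose e := m / (4 * (A + 1)).
have e0 : 0 < e by rewrite divr_gt0// mulr_gt0// ltr_wpDl.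
have c2t := c2 t0 To; have neut := neu t0 To.
have [c2n _ _] := C2_closure_lincomb (-1) 0 oO c2t c2t.
have neun := neumann_lincomb (-1) 0 oO c2t c2t neut neut.
have mxn y : Omega y -> -1 * Z y t0 + 0 * Z y t0 <= -1 * Z x0 t0 + 0 * Z x0 t0.
  by move=> /minZ H; rewrite !mul0r !addr0 !mulN1r lerN2.
have lapn := max_laplacian sO c2n neun cx0 mxn e0.
have drift : \forall y \near within Omega (nbhs x0),
    m / 4 <= Zt y t0 - K * Z y t0.
  have Zy := cvgr_le _ (slice t0 Tc).
  have {}Zy : \forall y \near within Omega (nbhs x0), Z y t0 <= - (m / 2).
    apply: Zy; rewrite -[X in X < _]opprK -/m ltrN2 gtr_pMr// invf_lt1// ltr1n//.
  near=> y.
  have Oy : Omega y by near: y; exact: near_withinT.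
  have [|a [c [a0 aA cC ->]]] := eqn y t0 Oy; first by rewrite t00.
  apply: (drift_bound (m := m) (A := A) (e := e)) => //; first exact: CK.
    have : laplacian (fun x => -1 * Z x t0 + 0 * Z x t0) y < e by near: y.
    rewrite (laplacian_lincomb (-1) 0 oO c2t c2t Oy) mul0r addr0 mulN1r.
    by rewrite ltrNl.
  by near: y.
have cGZ : {within closure Omega `*` time_oo T,
    continuous (fun p : 'rV[R]_n * R => G p - K * Z p.1 p.2)}.
  move=> p; apply: cvgB; first exact: cG.
  apply: cvgMl_tmp; apply: (continuous_subspaceW _ c0) => -[y s] [/= cy [s0 sT]].
  by split=> //=; split=> //; exact: ltW.
have lim_drift : m / 4 <= G (x0, t0) - K * Z x0 t0.
  have sl := within_slice_left To cGZ.
  have := extension_cvg subO sl (fun _ _ => erefl) cx0.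
  move=> /cvgr_to_ge; apply; near=> y.
  rewrite /= GE; first by near: y; exact: drift.
  by split=> //=; near: y; exact: near_withinT.
(* Weakening $m/4$ to $m/8$ makes the inequality strict, hence stable on a space-time neighbourhood
   of $(x_0,t_0)$. *)
have m8 : 0 < m / 8 by rewrite divr_gt0.
have m84 : m / 8 < G (x0, t0) - K * Z x0 t0.
  by apply: lt_le_trans lim_drift; rewrite ltr_pM2l// ltf_pV2 ?posrE// ltr_nat.
move/subspace_continuousP : cGZ => /(_ (x0, t0) (conj cx0 To)) cGZ.
have [[U V] [/= nU /nbhs_ballP[r/= r0 Vr]] UV] := cvgr_gt _ cGZ _ m84.
pose d := Num.min (r / 2) (t0 / 2).
have d0 : 0 < d by rewrite lt_min !divr_gt0.
have dr : d < r.
  rewrite gt_min; apply/orP; left.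
  by rewrite gtr_pMr// invf_lt1// ltr1n.
have dt : d < t0.
  rewrite gt_min; apply/orP; right.
  by rewrite gtr_pMr// invf_lt1// ltr1n.
pose s1 := t0 - d.
have s10 : 0 < s1 by rewrite subr_gt0.
have s1t : s1 < t0 by rewrite ltrBlDr ltrDl.
(* A lower bound for the increase of [zeta y] over $[s_1,t_0]$ that does not depend on $y$, so it
   survives the limit $y\to x_0$. *)
pose kappa := expR (- K * t0) * (m / 8) * (t0 - s1).
have kappa0 : 0 < kappa by rewrite !mulr_gt0 ?expR_gt0 ?subr_gt0.
have inc : \forall y \near within Omega (nbhs x0), kappa <= zeta y t0 - zeta y s1.
  rewrite near_withinE; apply: filterS nU => y Uy Oy.
  have inT s : s1 <= s <= t0 -> time_oo T s.
    move=> /andP[ls st]; apply: ooT.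
    by rewrite (lt_le_trans s10)//= (le_trans st).
  have D (s : R) : s1 <= s <= t0 ->
      is_derive s 1 (zeta y) (expR (- K * s) * (Zt y s - K * Z y s)).
    by move=> /inT Ts; apply: is_derive_expR_mul; exact: dZ.
  have Cz : {within `[s1, t0], continuous (zeta y)}.
    by apply: derivable_within_continuous => s; rewrite in_itv/= => /D[].
  have D' (s : R) : s \in `]s1, t0[ ->
      is_derive s 1 (zeta y) (expR (- K * s) * (Zt y s - K * Z y s)).
    by rewrite in_itv/= => /andP[a b]; apply: D; rewrite !ltW.
  have [c] := MVT s1t D' Cz; rewrite in_itv/= => /andP[s1c ct] ->.
  have Tcc : time_oo T c by apply: inT; rewrite !ltW.
  rewrite /kappa ler_pM2r ?subr_gt0//.
  have Vc : V c.
    apply: Vr; rewrite /ball/= gtr0_norm ?subr_gt0//.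
    by apply: lt_trans dr; rewrite ltrBlDr -ltrBlDl.
  have := UV (y, c) (conj Uy Vc) (conj (subO _ Oy) Tcc).
  rewrite /from_subspace/= GE//= => /ltW Hd.
  apply: ler_pM; [exact: expR_ge0|exact: ltW| |exact: Hd].
  by rewrite ler_expR !mulNr lerN2 ler_pM2l// ltW.
have s1T : 0 <= s1 <= T' by rewrite ltW//= (le_trans (ltW s1t)).
have lim : zeta y t0 - zeta y s1 @[y --> within Omega (nbhs x0)] -->
    zeta x0 t0 - zeta x0 s1.
  by apply: cvgB; apply: cvgMl_tmp; apply: slice => //; exact: coT.
have := cvgr_to_ge lim inc.
have := minz x0 s1 cx0 s1T; rewrite -subr_le0 => H1 H2.
by have := lt_le_trans kappa0 (le_trans (H2 PF) H1); rewrite ltxx.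
Unshelve. all: by end_near. Qed.

End ParabolicMinimum.

(** * The chemotaxis system *)

(** Allows closed conditions known at positive times to be passed to $t=0$. *)
Lemma time_oo_proper {R : realType} (T : \bar R) : (0 < T)%E ->
  ProperFilter (within (time_oo T) (nbhs (0 : R))).
Proof.
move=> T0; have [t [t0 tT]] : exists t : R, 0 < t /\ (t%:E < T)%E.
  case: T T0 => [r| |] //.
    rewrite lte_fin => r0; exists (r / 2); rewrite divr_gt0// lte_fin.
    by rewrite gtr_pMr// invf_lt1// ltr1n.
  by move=> _; exists 1; rewrite ltry.
apply: within_nbhs_proper => A /nbhs_ballP[r/= r0 rA].
exists (Num.min (r / 2) t); split.
  split; first by rewrite lt_min t0 divr_gt0.
  by apply: le_lt_trans tT; rewrite lee_fin ge_min lexx orbT.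
apply: rA; rewrite /ball/= sub0r normrN ger0_norm.
  by rewrite gt_min gtr_pMr// invf_lt1// ltr1n.
by rewrite le_min !ltW// divr_gt0.
Qed.

Section KellerSegel.
Context {R : realType} {n : nat} (Omega : set 'rV[R]_n) (mu : R) (gamma : R -> R).
Context (u0 : 'rV[R]_n -> R) (T : \bar R) (u v : 'rV[R]_n -> R -> R).
Context (h h1 h2 : R -> R).
Context (sO : smooth_bounded_domain Omega) (mu0 : 0 <= mu).
Context (dh : forall s : R, is_derive s 1 h (h1 s)).
Context (dh1 : forall s : R, is_derive s 1 h1 (h2 s)) (ch2 : continuous h2).
Context (hE : forall s, 0 <= s -> h s = gamma s).
Context (hpos : forall s, 0 <= s -> 0 < h s).
Context (hdecr : forall a b, 0 <= a -> a <= b -> h b <= h a).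
Context (u0_ge0 : forall x, Omega x -> 0 <= u0 x).
Context (sol : classical_solution Omega mu gamma u0 T u v).

Let oO : open Omega. Proof. by have [] := sO. Qed.
Let subO : Omega `<=` closure Omega. Proof. exact: subset_closure. Qed.
Let cO : compact (closure Omega).
Proof. by have [_ _ _ bO _] := sO; exact: closure_compact. Qed.
Let ch : continuous h. Proof. by move=> s; exact: is_derive_continuous (dh s). Qed.
Let ch1 : continuous h1. Proof. by move=> s; exact: is_derive_continuous (dh1 s). Qed.

Let z x t := h (v x t) * u x t.
Let f x t := mu * u x t * (1 - u x t).
Let vt := time_derivative v.

Let c2u t : time_oo T t -> C2_closure Omega (u ^~ t).
Proof. exact: C21_slice (csol_u_C21 sol). Qed.
Let c2v t : time_oo T t -> C2_closure Omega (v ^~ t).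
Proof. exact: C21_slice (csol_v_C21 sol). Qed.
Let neuv t : time_oo T t -> neumann_condition Omega (v ^~ t).
Proof. by move=> Tt; have := csol_v_neumann sol Tt. Qed.

Let c2z t : time_oo T t -> C2_closure Omega (z ^~ t).
Proof.
move=> Tt; have [c2hv _] := C2_closure_comp oO dh dh1 ch2 (c2v Tt).
by have [] := C2_closureM oO c2hv (c2u Tt).
Qed.

Let neuz t : time_oo T t -> neumann_condition Omega (z ^~ t).
Proof.
move=> Tt; have [c2hv _] := C2_closure_comp oO dh dh1 ch2 (c2v Tt).
apply: (neumannM oO c2hv (c2u Tt)); last exact: (csol_u_neumann sol Tt).
exact: neumann_comp oO dh dh1 ch2 (c2v Tt) (neuv Tt).
Qed.

Let ut_eq x t : Omega x -> time_oo T t ->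
  time_derivative u x t = laplacian (z ^~ t) x + f x t.
Proof.
move=> Ox Tt.
have -> : laplacian (z ^~ t) x = laplacian (fun y => gamma (v y t) * u y t) x.
  apply: (laplacian_eq_on oO Ox) => y Oy.
  by rewrite /z hE//; exact: (csol_dom sol Oy Tt).
exact: (csol_u_eq sol Ox Tt).
Qed.

Let v_eq x t : Omega x -> time_oo T t -> v x t - laplacian (v ^~ t) x = u x t.
Proof. by move=> Ox Tt; rewrite -(csol_v_eq sol Ox Tt) addrC. Qed.

(** Here [a] is the inverse time step. Applying $I-\Delta$ to $s$ times (quotient of $v$ plus $z$)
    minus [W] leaves $s$ times the error of the difference quotient of $u$, since [lz + b] is $u_t$,
    plus the term that the barrier inequality makes nonpositive. *)
Let quotient_identity (s a b va vb la lb ua ub zz lz W lW : R) :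
  va - la = ua -> vb - lb = ub ->
  1 * (s * a * va + - (s * a) * vb) + 1 * (s * zz + -1 * W) -
  (1 * (s * a * la + - (s * a) * lb) + 1 * (s * lz + -1 * lW)) =
  s * (a * (ua - ub) - (lz + b)) + (s * (zz + b) - (W - lW)).
Proof. by move=> <- <-; ring. Qed.

Let quotient_bound (s q l d : R) : `|q - l| < d -> s * (q - l) <= `|s| * d.
Proof.
move=> ql; apply: le_trans (ler_norm _) _; rewrite normrM.
by rewrite ler_wpM2l// ltW.
Qed.

(* [(I - Delta)(v_t + gamma(v) u) = gamma(v) u + mu u (1 - u)], tested against a
   barrier [W]; as [v_t] need not be C^2 in space, it is replaced by a difference
   quotient. *)
Let vt_comparison (s : R) (W : 'rV[R]_n -> R) t : time_oo T t ->
  C2_closure Omega W -> neumann_condition Omega W ->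
  (forall x, Omega x -> s * (z x t + f x t) <= W x - laplacian W x) ->
  forall x, Omega x -> s * (vt x t + z x t) <= W x.
Proof.
move=> Tt c2W neuW HW x Ox; apply/ler_addgt0Pr => e e0.
(* The quotient error enters twice, through $u$ in the comparison and through $v$ on returning to
   $v_t$; the summand 1 covers $s=0$. *)
pose d := e / (2 * (`|s| + 1)).
have s1 : 0 < `|s| + 1 by rewrite ltr_wpDl.
have d0 : 0 < d by rewrite divr_gt0// mulr_gt0.
have sd : `|s| * d + `|s| * d <= e.
  have -> : e = `|s| * d + `|s| * d + (d + d) by rewrite /d; field; rewrite gt_eqF.
  by rewrite lerDl ltW// addr_gt0.
have [a Ha] : exists a : R, [/\ 0 < a, time_oo T (t + a),
    (forall y, Omega y ->
      `|a^-1 * (u y (t + a) - u y t) - time_derivative u y t| < d) &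
    (forall y, Omega y ->
      `|a^-1 * (v y (t + a) - v y t) - time_derivative v y t| < d)].
  apply: (@filter_ex _ (0 : R)^'+); near=> a; split.
  - by near: a; exact: nbhs_right_gt.
  - near: a; apply/(nbhs_right0P t)/cvg_within.
    by apply: open_nbhs_nbhs; split=> //; exact: time_oo_open.
  - by near: a; exact: (time_quotient_uniform cO (csol_u_C21 sol) Tt d0).
  - by near: a; exact: (time_quotient_uniform cO (csol_v_C21 sol) Tt d0).
have [a0 Ta Hu Hv] := Ha.
have [cA _ _] := C2_closure_lincomb (s * a^-1) (- (s * a^-1)) oO (c2v Ta) (c2v Tt).
have nA := neumann_lincomb (s * a^-1) (- (s * a^-1)) oO (c2v Ta) (c2v Tt)
  (neuv Ta) (neuv Tt).
have [cB _ _] := C2_closure_lincomb s (-1) oO (c2z Tt) c2W.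
have nB := neumann_lincomb s (-1) oO (c2z Tt) c2W (neuz Tt) neuW.
have [c2p _ _] := C2_closure_lincomb 1 1 oO cA cB.
have nep := neumann_lincomb 1 1 oO cA cB nA nB.
have := elliptic_comparison sO c2p nep (C := `|s| * d) _ Ox.
have Hp y : Omega y ->
  1 * (s * a^-1 * v y (t + a) + - (s * a^-1) * v y t) + 1 * (s * z y t + -1 * W y) -
  laplacian (fun y => 1 * (s * a^-1 * v y (t + a) + - (s * a^-1) * v y t) +
                      1 * (s * z y t + -1 * W y)) y <= `|s| * d.
  move=> Oy; rewrite (laplacian_lincomb 1 1 oO cA cB Oy).
  rewrite (laplacian_lincomb _ _ oO (c2v Ta) (c2v Tt) Oy).
  rewrite (laplacian_lincomb _ _ oO (c2z Tt) c2W Oy).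
  rewrite (quotient_identity s a^-1 (f y t) (z y t) _ (W y) _ (v_eq Oy Ta) (v_eq Oy Tt)).
  rewrite -(ut_eq Oy Tt); apply: (@le_trans _ _ (`|s| * d + 0)); last by rewrite addr0.
  apply: lerD; first exact: quotient_bound (Hu y Oy).
  by rewrite subr_le0; exact: HW.
move=> /(_ Hp) H.
have := quotient_bound (- s) (Hv x Ox); rewrite normrN -/vt => H'.
apply: le_trans (_ : W x + (`|s| * d + `|s| * d) <= _); last by rewrite lerD2l.
clear -H H'; move: H H'.
move: (v x (t + a)) (v x t) (vt x t) (z x t) (W x) (`|s| * d) (a^-1).
move=> va vb vtx zx Wx sd' i H H'.
have -> : s * (vtx + zx) = (1 * (s * i * va + - (s * i) * vb) + 1 * (s * zx + -1 * Wx)) +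
   (- s * (i * (va - vb) - vtx)) + Wx by ring.
by rewrite addrC lerD2l lerD.
Unshelve. all: by end_near. Qed.

Let bounded_on_cylinder (T' : R) (F : 'rV[R]_n -> R -> R) : (T'%:E < T)%E ->
  C0_cylinder Omega T F ->
  exists2 M, 0 <= M & forall x t, Omega x -> 0 <= t <= T' -> `|F x t| <= M.
Proof.
move=> T'T cF; pose K := closure Omega `*` `[0, T'].
have cFK : {within K, continuous (fun p : 'rV[R]_n * R => F p.1 p.2)}.
  apply: (continuous_subspaceW _ cF) => -[y s] [/= cy].
  rewrite in_itv/= => /andP[s0 sT]; split=> //=; split=> //.
  by rewrite (le_lt_trans _ T'T)// lee_fin.
have cK : compact K by apply: compact_setX => //; exact: segment_compact.
have /ex_strict_bound_gt0[M M0 HM] := compact_bounded (continuous_compact cFK cK).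
exists M; first exact: ltW.
move=> x t Ox tT; apply/ltW/HM; exists (x, t) => //; split=> /=; first exact: subO.
by rewrite in_itv.
Qed.

Let C0h (k : R -> R) : continuous k -> C0_cylinder Omega T (fun x t => k (v x t)).
Proof.
move=> ck; exact: (within_continuous_comp_real ck (csol_v_C0 sol)).
Qed.

Let C0z : C0_cylinder Omega T z.
Proof.
by move=> p; apply: cvgM; [exact: (C0h ch)|exact: (csol_u_C0 sol)].
Qed.

Let C0f : C0_cylinder Omega T f.
Proof.
move=> p; apply: cvgM.
  by apply: cvgMl_tmp; exact: (csol_u_C0 sol).
by apply: cvgB; [exact: cvg_cst|exact: (csol_u_C0 sol)].
Qed.

(** A constant barrier satisfies $W-\Delta W=W$, so [M1 + M2] works for $s=1$ and $s=-1$, bounding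
    $|v_t+z|$; one more [M1] removes $z$. *)
Let vt_bounded (T' : R) : (T'%:E < T)%E ->
  exists2 B, 0 <= B & forall x t, Omega x -> 0 < t <= T' -> `|vt x t| <= B.
Proof.
move=> T'T; have [M1 M10 H1] := bounded_on_cylinder T'T C0z.
have [M2 M20 H2] := bounded_on_cylinder T'T C0f.
exists (M1 + (M1 + M2)) => [|x t Ox /andP[t0 tT]]; first by rewrite !addr_ge0.
have Tt : time_oo T t by split=> //; rewrite (le_lt_trans _ T'T)// lee_fin.
have tT' : 0 <= t <= T' by rewrite ltW.
have HW (s : R) : `|s| = 1 -> s * (vt x t + z x t) <= M1 + M2.
  move=> s1; apply: (vt_comparison (W := fun=> M1 + M2) Tt _ _ _ Ox) => [||y Oy].
  - exact: C2_closure_cst.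
  - exact: neumann_cst.
  - rewrite laplacian_cst subr0 (le_trans (ler_norm _))// normrM s1 mul1r.
    by rewrite (le_trans (ler_normD _ _))// lerD// ?H1 ?H2.
have : `|vt x t + z x t| <= M1 + M2.
  by rewrite ler_norml lerNl -mulN1r -[X in _ && (X <= _)]mul1r !HW ?normrN ?normr1.
have := H1 x t Ox tT'.
move=> Hz Hs; rewrite -[vt x t](addrK (z x t)) (le_trans (ler_normB _ _))//.
by rewrite addrC lerD.
Qed.

(** * The equation for $z$ and nonnegativity of $u$ *)

Let zt x t := h1 (v x t) * vt x t * u x t + h (v x t) * time_derivative u x t.

Let dz x t : Omega x -> time_oo T t -> is_derive t 1 (z x) (zt x t).
Proof.
move=> Ox Tt.
have du := C21_is_derive (csol_u_C21 sol) Ox Tt.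
have dv := C21_is_derive (csol_v_C21 sol) Ox Tt.
have dhv : is_derive t (1 : R) (fun s => h (v x s)) (h1 (v x t) * vt x t).
  exact: is_derive1_comp (dh _) dv.
apply: is_derive_eq (is_deriveM dhv du) _.
by rewrite /zt /GRing.scale/= addrC [u x t * _]mulrC.
Qed.

Let ext_zt : extends_continuously (Omega `*` time_oo T) (closure Omega `*` time_oo T)
  (fun p : 'rV[R]_n * R => zt p.1 p.2).
Proof.
have [cu _ eut _ _] := csol_u_C21 sol; have [cv _ evt _ _] := csol_v_C21 sol.
have ext (k : R -> R) : continuous k ->
    extends_continuously (Omega `*` time_oo T) (closure Omega `*` time_oo T)
      (fun p : 'rV[R]_n * R => k (v p.1 p.2)).
  move=> ck; apply: extends_continuously_self.
  exact: (within_continuous_comp_real ck cv).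
apply: extends_continuouslyD; apply: extends_continuouslyM.
- apply: extends_continuouslyM; first exact: ext.
  exact: evt.
- exact: extends_continuously_self cu.
- exact: ext.
- exact: eut.
Qed.

Let reaction (m hv h1v vtx ux L : R) : hv != 0 ->
  h1v * vtx * ux + hv * (L + m * ux * (1 - ux)) =
  hv * L + (m * (1 - ux) + h1v * vtx / hv) * (hv * ux).
Proof. by move=> hv0; field. Qed.

Let u_ge0 x t : Omega x -> time_oo T t -> 0 <= u x t.
Proof.
move=> Ox Tt; have [t0 tT] := Tt.
have [Mv Mv0 Hv] := bounded_on_cylinder tT (csol_v_C0 sol).
have [Mu Mu0 Hu] := bounded_on_cylinder tT (csol_u_C0 sol).
have [M1 M10 H1] := bounded_on_cylinder tT (C0h ch1).
have [B B0 HB] := vt_bounded tT.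
have hMv : 0 < h Mv by exact: hpos.
suff : 0 <= z x t.
  by rewrite /z pmulr_rge0//; apply/hpos; exact: (csol_dom sol Ox Tt).
(* By monotonicity [h 0] bounds $h(v)$ from above and [h Mv] bounds it from below, since $0\le v\le$
   [Mv]. In [C], [1 + Mu] bounds $1-u$ and [M1 * B] bounds $|h'(v)v_t|$. *)
apply: (parabolic_nonneg (A := h 0) (C := mu * (1 + Mu) + M1 * B / h Mv)
  sO t0 tT C0z c2z neuz dz ext_zt) => //.
- move=> y Oy; rewrite /z (csol_init sol Oy) mulr_ge0 ?u0_ge0// ltW//.
  apply: hpos.
  (* [csol_dom] speaks of positive times; $v(y,0)\ge0$ follows by letting $t\to0$. *)
  have c0 := within_slice_right (subO Oy) (csol_v_C0 sol).
  have Tc0 : time_co T 0 by split=> //; rewrite (lt_trans _ tT)// lte_fin.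
  have := extension_cvg (D := time_oo T) _ c0 (fun _ _ => erefl) Tc0.
  have sub : time_oo T `<=` time_co T by move=> r [/ltW].
  move=> /(_ sub) /= lim.
  have PF' := time_oo_proper (lt_trans (t0 : (0%:E < t%:E)%E) tT).
  apply: cvgr_to_ge lim _; rewrite near_withinE; apply: nearW => r Tr.
  exact: (csol_dom sol Oy Tr).
- move=> y s Oy /andP[s0 st].
  have Ts : time_oo T s by split=> //; rewrite (le_lt_trans _ tT)// lee_fin.
  have st' : 0 <= s <= t by rewrite ltW.
  have v0 : 0 <= v y s by exact: (csol_dom sol Oy Ts).
  have hv0 : 0 < h (v y s) by exact: hpos.
  exists (h (v y s)), (mu * (1 - u y s) + h1 (v y s) * vt y s / h (v y s)); split.
  + exact: ltW.
  + exact: hdecr.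
  + apply: lerD.
      rewrite ler_wpM2l// lerD2l lerNl; have := Hu y s Oy st'.
      by rewrite ler_norml => /andP[].
    apply: le_trans (ler_norm _) _; rewrite !normrM normfV (gtr0_norm hv0).
    apply: ler_pM => //; first by rewrite invr_ge0 ltW.
      by apply: ler_pM => //; [exact: H1|apply: HB; rewrite ?s0].
    rewrite lef_pV2 ?posrE//; apply: hdecr => //.
    exact: le_trans (ler_norm _) (Hv y s Oy st').
  + by rewrite /zt (ut_eq Oy Ts) /f /z; apply: reaction; rewrite gt_eqF.
- by rewrite lexx ltW.
Qed.

(** * The differential inequality for $v$ and its initial value *)

Let growth_bound (g m hv ux : R) : 0 <= ux -> hv <= g -> 0 <= m ->
  hv * ux + m * ux * (1 - ux) <= (g + m) * ux.
Proof.
move=> ux0 hg m0; rewrite -subr_ge0.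
have -> : (g + m) * ux - (hv * ux + m * ux * (1 - ux)) =
  (g - hv) * ux + m * (ux * ux) by ring.
by rewrite addr_ge0// !mulr_ge0// subr_ge0.
Qed.

Lemma time_derivative_le (g : R) x t :
  (forall y, Omega y -> h (v y t) <= g) -> Omega x -> time_oo T t ->
  time_derivative v x t <= (g + mu) * v x t.
Proof.
move=> Hg Ox Tt.
have [c2 _ _] := C2_closure_lincomb (g + mu) 0 oO (c2v Tt) (c2v Tt).
have neu := neumann_lincomb (g + mu) 0 oO (c2v Tt) (c2v Tt) (neuv Tt) (neuv Tt).
have := vt_comparison (s := 1) Tt c2 neu _ Ox; rewrite mul1r mul0r addr0 => H.
(* Since $z\ge0$, it may be added to $v_t$. *)
apply: le_trans (H _).
  rewrite lerDl /z mulr_ge0 ?u_ge0// ltW//; apply/hpos.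
  exact: (csol_dom sol Ox Tt).
move=> y Oy; rewrite (laplacian_lincomb _ _ oO (c2v Tt) (c2v Tt) Oy).
rewrite mul1r !mul0r !addr0 -mulrBr (v_eq Oy Tt).
by apply: growth_bound => //; [exact: u_ge0|exact: Hg].
Qed.

(** For small $t>0$ the slice $v(\cdot,t)$ is an admissible approximant: it is $C^2$ with Neumann
    condition, and its Laplacian $v-u$ tends uniformly to $v(\cdot,0)-u_0$ by continuity on the
    compact closure. *)
Lemma neumann_laplacian_init : (0 < T)%E -> {within closure Omega, continuous u0} ->
  neumann_laplacian Omega (v ^~ 0) (fun x => v x 0 - u0 x).
Proof.
move=> T0 cu0; have Tc0 : time_co T 0 by [].
have cv0 := within_slice_left Tc0 (csol_v_C0 sol).
split=> //; first by move=> x; apply: cvgB; [exact: cv0|exact: cu0].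
move=> e e0; have e20 : 0 < e / 2 by rewrite divr_gt0.
have sub : time_oo T `<=` time_co T by move=> r [/ltW].
have Hv := compact_slice_continuous cO (csol_v_C0 sol) Tc0 e20.
have Hu := compact_slice_continuous cO (csol_u_C0 sol) Tc0 e20.
have PF' := time_oo_proper T0.
have [t [Tt Hvt Hut]] : exists t : R, [/\ time_oo T t,
    (forall x, closure Omega x -> `|v x 0 - v x t| < e / 2) &
    (forall x, closure Omega x -> `|u x 0 - u x t| < e / 2)].
  apply: (@filter_ex _ (within (time_oo T) (nbhs (0 : R)))).
  near=> t; split.
  - by near: t; exact: near_withinT.
  - by near: t; apply: (within_subset _ sub); exact: Hv.
  - by near: t; apply: (within_subset _ sub); exact: Hu.
exists (v ^~ t); split; [exact: c2v|exact: neuv|move=> x Ox].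
have Dv := Hvt x (subO Ox); have Du := Hut x (subO Ox).
split; first by rewrite distrC (lt_trans Dv)// gtr_pMr// invf_lt1// ltr1n.
have -> : laplacian (v ^~ t) x = v x t - u x t by rewrite -(v_eq Ox Tt) opprB addrC subrK.
rewrite -(csol_init sol Ox).
have -> : v x t - u x t - (v x 0 - u x 0) = (u x 0 - u x t) - (v x 0 - v x t) by ring.
by rewrite (le_lt_trans (ler_normB _ _))// [e]splitr ltrD.
Unshelve. all: by end_near. Qed.

End KellerSegel.

(** * Integration in time and conclusion *)

Lemma exponential_bound {R : realType} (f : R -> R) (df : R -> R) (K t : R) :
  0 <= t -> {within `[0, t], continuous f} ->
  (forall s, 0 < s < t -> is_derive (s : R) 1 f (df s)) ->
  (forall s, 0 < s < t -> df s <= K * f s) ->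
  f t <= f 0 * expR (K * t).
Proof.
(* Gronwall's argument: the differential inequality says that $e^{-Ks}f(s)$ is nonincreasing, for
   either sign of [K]. *)
move=> t0 cf Df Hf; pose g s := expR (- K * s) * f s.
have Dg (s : R) : 0 < s < t -> is_derive s 1 g (expR (- K * s) * (df s - K * f s)).
  by move=> /Df; exact: is_derive_expR_mul.
have cg : {within `[0, t], continuous g}.
  move=> s; apply: cvgM; last exact: cf.
  apply: (@continuous_subspaceT _ _ _ (fun r : R => expR (- K * r))) => r.
  apply: (@cvg_comp _ _ _ (fun r : R => - K * r) expR _ (nbhs (- K * r))).
    by apply: cvgMl_tmp; exact: cvg_id.
  exact: continuous_expR.
have dg s : s \in `]0, t[ -> derivable g s 1.
  by rewrite in_itv/= => /Dg[].
have dg0 s : s \in `]0, t[ -> derive1 g s <= 0.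
  rewrite in_itv/= => st; rewrite derive1E; have [_ ->] := Dg s st.
  by rewrite pmulr_rle0 ?expR_gt0// subr_le0; exact: Hf.
have := ler0_derive1_le_cc dg dg0 cg (x := t) (y := 0).
rewrite !in_itv/= !lexx t0 => /(_ isT isT isT).
rewrite /g mulr0 expR0 mul1r mulNr expRN => H.
by rewrite -ler_pdivrMr ?expR_gt0// mulrC.
Qed.

Lemma gamma_nonincreasing {R : realType} (gamma h h1 : R -> R) :
  (forall s : R, is_derive s 1 h (h1 s)) ->
  (forall s, 0 < s -> h1 s = derive1 gamma s) ->
  (forall s, 0 < s -> derive1 gamma s <= 0) ->
  forall a b, 0 <= a -> a <= b -> h b <= h a.
Proof.
move=> dh h1E dg a b; apply: ler0_derive1_nincry => [s _|s|].
- by have [] := dh s.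
- rewrite in_itv/= andbT => s0; rewrite derive1E.
  by have [_ ->] := dh s; rewrite h1E// dg.
- apply: continuous_subspaceT => s; exact: is_derive_continuous (dh s).
Qed.

Theorem lemma3p2 (R : realType) (n : nat) (Omega : set 'rV[R]_n) (mu : R)
    (gamma : R -> R) (u0 : 'rV[R]_n -> R) (Tmax : \bar R)
    (u v : 'rV[R]_n -> R -> R) (vstar : R) :
  (1 <= n)%N ->
  smooth_bounded_domain Omega ->
  0 <= mu ->
  C3_half_line gamma ->
  (forall s, 0 < s -> 0 < gamma s /\ derive1 gamma s <= 0) ->
  {within closure Omega, continuous u0} ->
  (forall x, closure Omega x -> 0 <= u0 x) ->
  (exists2 x, closure Omega x & u0 x != 0) ->
  maximal_classical_solution Omega mu gamma u0 Tmax u v ->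
  is_v_star Omega mu Tmax v vstar ->
  let v0 := inv_I_sub_neumann_laplacian Omega u0 in
  forall x t, Omega x -> 0 <= t -> (t%:E < Tmax)%E ->
    v x t <= v0 x * expR ((gamma vstar + mu) * t).
Proof.
move=> _ sO mu0 C3 Hgamma cu0 u0_ge0 _ [T0 sol _] [vs1 vs2] v0 x t Ox t0 tT.
have [h [h1 [h2 [dh dh1 ch2 hE h1E]]]] := C3_half_line_extension C3.
have hdecr := gamma_nonincreasing dh h1E (fun s s0 => (Hgamma s s0).2).
(* Positivity of [gamma] is assumed on $(0,\infty)$; at $0$ it follows from $h(0)\ge h(1)>0$. *)
have hpos s : 0 <= s -> 0 < h s.
  rewrite le_eqVlt => /predU1P[<-|s0]; last by rewrite hE ?(Hgamma s s0).1 ?ltW.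
  by rewrite (lt_le_trans _ (hdecr 0 1 _ _))// hE// (Hgamma 1 ltr01).1.
have u0O y : Omega y -> 0 <= u0 y by move=> Oy; apply/u0_ge0/subset_closure.
have -> : v0 x = v x 0.
  have init := neumann_laplacian_init sO sol T0 cu0.
  exact: (inv_I_sub_neumann_laplacianE (w := v ^~ 0) sO init Ox).
have vstarP : 0 <= vstar /\ forall y s, Omega y -> time_oo Tmax s -> vstar <= v y s.
  have [mu_eq0|mu_neq0] := eqVneq mu 0.
    have [vpos vinf] := vs2 mu_eq0; split=> [|y s Oy Ts]; first exact: ltW.
    (* [inf] is a lower bound only for a set bounded below, which $v\ge0$ guarantees. *)
    apply: le_trans (vinf s Ts) _; apply: ge_inf; last by exists y.
    by exists 0 => _ [w Ow <-]; exact: (csol_dom sol Ow Ts).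
  have -> : vstar = 0 by apply: vs1; rewrite lt_neqAle eq_sym mu_neq0.
  by split=> // y s Oy Ts; exact: (csol_dom sol Oy Ts).
have [vstar0 vstar_le] := vstarP.
have ooT s : 0 < s < t -> time_oo Tmax s.
  by move=> /andP[s0 st]; split=> //; rewrite (lt_trans _ tT)// lte_fin.
apply: (exponential_bound (df := time_derivative v x) t0).
- have cv := within_slice_right (subset_closure Ox) (csol_v_C0 sol).
  apply: (continuous_subspaceW _ cv) => s; rewrite /= in_itv/= => /andP[s0 st].
  by split=> //; rewrite (le_lt_trans _ tT)// lee_fin.
- by move=> s /ooT Ts; exact: C21_is_derive (csol_v_C21 sol) Ox Ts.
- move=> s /ooT Ts; rewrite -(hE _ vstar0).
  apply: (time_derivative_le sO mu0 dh dh1 ch2 hE hpos hdecr u0O sol) => // y Oy.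
  by apply: hdecr => //; exact: vstar_le.
Qed.
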